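(* Let $K$ be an infinite field, $R=K[x_1,\ldots,x_n]$ the polynomial ring in $n\ge 1$ variables with the standard grading, and $\mathfrak m=(x_1,\ldots,x_n)$. Let $I$ be a homogeneous $\mathfrak m$-primary $\mathfrak m$-full ideal of $R$, and let $d$ be the minimum of all $j$ with $\beta_{n-1,n-1+j}(I)>0$. Then the following conditions are equivalent. (i) $R/I$ has the weak Lefschetz property. (ii) $\beta_{n-1,n-1+j}(I)=\beta_{0,j}(I)$ and $\beta_{n-2,n-2+j}(I)=(n-1)\,\beta_{0,j}(I)$ for all $j>d$. (iii) $\beta_{i,i+j}(I)=\binom{n-1}{i}\beta_{0,j}(I)$ for all $j>d$ and all $i$.
   Context: An ideal $I$ of $R$ is $\mathfrak m$-full if there exists an element $x\in R$ such that $\mathfrak m I:x=I$. $\beta_{i,j}(I)$ denotes the $(i,j)$th graded Betti number of $I$ as a graded $R$-module, i.e. $\beta_{i,j}(I)=\dim_K \mathrm{Tor}^R_i(I,K)_j$ (it is $0$ for $i<0$). For an $\mathfrak m$-primary homogeneous ideal $I$, write $A=R/I=\bigoplus_{i=0}^c A_i$ with $A_c\neq 0$. $A$ has the weak Lefschetz property (WLP) if there exists a linear form $L\in A_1$ such that the multiplication map $\times L:A_i\to A_{i+1}$ has full rank (i.e. is injective or surjective) for all $0\le i\le c-1$. *)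

(* Defs.v *)
From HB Require Import structures.
From mathcomp Require Import all_boot all_order all_algebra.
From mathcomp Require Import mpoly.

Set Implicit Arguments.
Unset Strict Implicit.
Unset Printing Implicit Defensive.

Import GRing.Theory.
Local Open Scope ring_scope.

Definition infinite (T : eqType) : Prop := ~ exists s : seq T, forall x, x \in s.

Section Ideals.
Variables (K : fieldType) (n : nat).
Implicit Types (I J : {mpoly K[n]} -> Prop).

Definition is_ideal I : Prop :=
  [/\ I 0, forall f g, I f -> I g -> I (f + g) & forall a f, I f -> I (a * f)].

Definition is_homogeneous I : Prop :=
  forall f (k : nat), I f -> I (pihomog mdeg k f).

Definition max_ideal (f : {mpoly K[n]}) : Prop :=
  exists c : 'I_n -> {mpoly K[n]}, f = \sum_(i < n) c i * 'X_i.

Definition ideal_mul I J (f : {mpoly K[n]}) : Prop :=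
  exists (r : nat) (a b : 'I_r -> {mpoly K[n]}),
    [/\ forall t, I (a t), forall t, J (b t) & f = \sum_(t < r) a t * b t].

Definition ideal_colon I (x f : {mpoly K[n]}) : Prop := I (x * f).

Definition radical I (f : {mpoly K[n]}) : Prop := exists k : nat, I (f ^+ k).

Definition is_primary I : Prop :=
  ~ I 1 /\ forall f g, I (f * g) -> I f \/ radical I g.

Definition m_primary I : Prop :=
  is_primary I /\ forall f, radical I f <-> max_ideal f.

Definition m_full I : Prop :=
  exists x, forall f, ideal_colon (ideal_mul max_ideal I) x f <-> I f.

(* With A_i = R_i / (I \cap R_i), a linear form of A is represented by a linear
   form L of R, and the map L : A_i -> A_(i+1) is described on representatives. *)
Definition mult_injective I (L : {mpoly K[n]}) (i : nat) : Prop :=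
  forall f, f \is i.-homog for mdeg -> I (L * f) -> I f.

Definition mult_surjective I (L : {mpoly K[n]}) (i : nat) : Prop :=
  forall g, g \is i.+1.-homog for mdeg ->
    exists2 f, f \is i.-homog for mdeg & I (g - L * f).

Definition is_top_degree I (c : nat) : Prop :=
  (exists2 f, f \is c.-homog for mdeg & ~ I f) /\
  forall (i : nat) f, (c < i)%N -> f \is i.-homog for mdeg -> I f.

Definition weak_Lefschetz I : Prop :=
  exists2 L, L \is 1.-homog for mdeg &
  exists2 c, is_top_degree I c &
  forall i : nat, (i < c)%N -> mult_injective I L i \/ mult_surjective I L i.

End Ideals.

(* p belongs to R(-a)_j = R_(j-a), which is 0 when j < a. *)
Definition shifted_homog (K : fieldType) (n : nat) (a j : int)
    (p : {mpoly K[n]}) : Prop :=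
  match j - a with
  | Posz e => p \is e.-homog for mdeg
  | Negz _ => p = 0
  end.

(* A graded free resolution ... -> F_1 -> F_0 -> I -> 0 by modules
   F_i = \bigoplus_l R(- res_shift i l) of finite rank.  Elements of F_i are row
   vectors, and matrices act on the right: res_diff i is F_(i+1) -> F_i. *)
Record graded_free_resolution (K : fieldType) (n : nat)
    (I : {mpoly K[n]} -> Prop) := GradedFreeResolution {
  res_rank : nat -> nat;
  res_shift : forall i, 'I_(res_rank i) -> int;
  res_aug : 'cV[{mpoly K[n]}]_(res_rank 0);
  res_diff : forall i, 'M[{mpoly K[n]}]_(res_rank i.+1, res_rank i);
  res_aug_homog : forall l, shifted_homog 0 (res_shift l) (res_aug l ord0);
  res_diff_homog : forall i k l,
    shifted_homog (@res_shift i l) (@res_shift i.+1 k) (res_diff i k l);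
  res_aug_image : forall f,
    I f <-> exists v : 'rV_(res_rank 0), f = (v *m res_aug) ord0 ord0;
  res_aug_exact : forall v : 'rV_(res_rank 0),
    v *m res_aug = 0 <-> exists w, v = w *m res_diff 0;
  res_diff_exact : forall i (v : 'rV_(res_rank i.+1)),
    v *m res_diff i = 0 <-> exists w, v = w *m res_diff i.+1
}.

Section Betti.
Variables (K : fieldType) (n : nat) (I : {mpoly K[n]} -> Prop).
Variable F : graded_free_resolution I.

(* The differential of F (x)_R K: the map R -> R/m = K is the constant
   coefficient. *)
Definition tor_diff (i : nat) : 'M[K]_(res_rank F i.+1, res_rank F i) :=
  map_mx (fun p : {mpoly K[n]} => p@_0%MM) (res_diff F i).

(* The row space is (F_i (x)_R K)_j, spanned by the generators of degree j. *)
Definition tor_chains (i : nat) (j : int) : 'M[K]_(res_rank F i) :=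
  diag_mx (\row_l (res_shift (g := F) l == j)%:R).

Definition tor_cycles (i : nat) (j : int) : 'M[K]_(res_rank F i) :=
  match i return 'M[K]_(res_rank F i) with
  | 0 => tor_chains 0 j
  | i'.+1 => (tor_chains i'.+1 j :&: kermx (tor_diff i'))%MS
  end.

Definition tor_boundaries (i : nat) (j : int) :
    'M[K]_(res_rank F i.+1, res_rank F i) :=
  tor_chains i.+1 j *m tor_diff i.

Lemma tor_diffK i : tor_diff i.+1 *m tor_diff i = 0.
Proof.
have D0 : res_diff F i.+1 *m res_diff F i = 0.
  apply/row_matrixP => k; rewrite row_mul row0.
  apply/res_diff_exact; exists (delta_mx 0 k); exact: rowE.
by rewrite /tor_diff -[map_mx _ (res_diff F i.+1) *m _]map_mxM D0 map_mx0.
Qed.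

Lemma tor_diff_degree i k l :
  res_shift (g := F) k != res_shift (g := F) l -> tor_diff i k l = 0.
Proof.
move=> neq; rewrite mxE; have := @res_diff_homog _ _ _ F i k l.
rewrite /shifted_homog; case: (_ - _) (subr_eq0 (res_shift k) (res_shift l)).
  move=> e e_eq hom; apply: (dhomog_nemf_coeff hom).
  by apply: contraNneq neq => /= e0; rewrite -e_eq -e0 mdeg0.
by move=> e _ ->; rewrite mcoeff0.
Qed.

Lemma tor_boundaries_sub_cycles i j :
  (tor_boundaries i j <= tor_cycles i j)%MS.
Proof.
have chains : (tor_boundaries i j <= tor_chains i j)%MS.
  suff -> : tor_boundaries i j = tor_diff i *m tor_chains i j by exact: submxMl.
  apply/matrixP => k l; rewrite /tor_boundaries mul_diag_mx mul_mx_diag !mxE.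
  have [->|neq] := eqVneq (res_shift (g := F) k) (res_shift (g := F) l).
    by rewrite mulrC.
  by have := tor_diff_degree neq; rewrite mxE => ->; rewrite mulr0 mul0r.
case: i chains => [//|i] chains; rewrite /tor_cycles sub_capmx chains.
by apply/sub_kermxP; rewrite -mulmxA tor_diffK mulmx0.
Qed.

(* \dim_K Tor_i^R(I, K)_j = \dim_K H_i(F (x)_R K)_j *)
Definition betti (i j : int) : nat :=
  match i with
  | Posz i' => (\rank (tor_cycles i' j) - \rank (tor_boundaries i' j))%N
  | Negz _ => 0%N
  end.

End Betti.

(* Main.v *)
(** An m-full ideal has a linear form x with mI : x = I, because on the socle of
    R/I multiplication by an element of m depends modulo mI only on its linear
    part.  For such an x the kernel of x on R/I is the socle, and xR \cap mI = xI.
    Computing Tor(I, K) as the Koszul homology of I/xI with respect to n - 1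
    variables y, the latter identity splits it into the part supported on
    (I \cap xR)/xI, which y annihilates, and the Koszul homology of the image I' of
    I in R/xR:
      beta_(i,i+j)(I) = C(n-1,i) s_j + beta_(i,i+j)(I'),
    where s_j is the dimension of the socle of R/I in degree j - 1, that is
    beta_(n-1,n-1+j)(I).  The kernel of any linear form contains the socle, so
    the weak Lefschetz property means exactly that x is surjective from degree
    d - 1 on, i.e. that I' contains all forms of degree >= d.  This in turn is
    equivalent to the vanishing of beta_(i,i+j)(I') for j > d and all i, and
    already to its vanishing for i = n - 2, since the latter says that R/(I + xR)
    has no socle in degrees >= d. *)
Require Import Defs.
From HB Require Import structures.
From mathcomp Require Import all_boot all_order all_algebra.
From mathcomp Require Import mpoly.
From mathcomp Require Import ring zify.
From Stdlib Require Import Classical.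

Set Implicit Arguments.
Unset Strict Implicit.
Unset Printing Implicit Defensive.

Import GRing.Theory.
Local Open Scope ring_scope.

(** * Dimensions of subquotients *)

Section QuotientDimension.
Variables (K : fieldType) (n : nat).
Implicit Types (V W : lmodType {mpoly K[n]}).

(** No quotient module is formed: a homology group is a pair of predicates, cycles and boundaries,
    on chains in one graded degree, and its dimension is asserted by exhibiting a basis. The Betti
    numbers come from an arbitrary graded free resolution, whereas the argument needs a Koszul
    complex. Since x and y generate m and x is a nonzerodivisor on I and on its syzygies, homology
    of degree p over I/xI can be moved along the resolution by connecting maps, down to degree 0 on
    the p-th syzygy, where it is compared with Tor. This rests on the exactness in positive degrees
    of the Koszul complex of R/xR, which an explicit contracting homotopy provides. The Betti
    numbers of I' are never computed: the decomposition only records a remainder h together with a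
    criterion for h = 0, which is all that the equivalences use. *)

Definition subspace V (P : V -> Prop) : Prop :=
  P 0 /\ forall (c : K) u v, P u -> P v -> P (c%:MP *: u + v).

(** Scalars of K act through constant polynomials, so that K-linear algebra and Koszul maps share
    one module structure. *)
Definition lcomb V k (v : 'I_k -> V) (c : 'rV[K]_k) : V :=
  \sum_i (c 0 i)%:MP *: v i.

(** A relation rather than a function: nothing guarantees beforehand that Z/B has finite dimension,
    and the predicates need not be decidable. *)
Definition quot_dim V (Z B : V -> Prop) (k : nat) : Prop :=
  exists v : 'I_k -> V,
    [/\ forall i, Z (v i),
        forall z, Z z -> exists c, B (z - lcomb v c) &
        forall c, B (lcomb v c) -> c = 0].

Lemma subspace0 V (P : V -> Prop) : subspace P -> P 0.
Proof. by case. Qed.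

Lemma subspaceZ V (P : V -> Prop) c u : subspace P -> P u -> P (c%:MP *: u).
Proof. by move=> [P0 PL] Pu; rewrite -[_ *: _]addr0; apply: PL. Qed.

Lemma subspaceD V (P : V -> Prop) u v : subspace P -> P u -> P v -> P (u + v).
Proof. by move=> [P0 PL] Pu Pv; rewrite -[u]scale1r -mpolyC1; apply: PL. Qed.

Lemma oppr_scale V (u : V) : - u = (-1 : K)%:MP *: u.
Proof. by rewrite mpolyCN mpolyC1 scaleN1r. Qed.

Lemma subspaceN V (P : V -> Prop) u : subspace P -> P u -> P (- u).
Proof. by move=> sP Pu; rewrite oppr_scale; apply: subspaceZ. Qed.

Lemma subspaceB V (P : V -> Prop) u v : subspace P -> P u -> P v -> P (u - v).
Proof. by move=> sP Pu Pv; apply: subspaceD => //; apply: subspaceN. Qed.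

Lemma subspace_sum V (P : V -> Prop) (I : Type) (r : seq I) (Q : pred I) F :
  subspace P -> (forall i, Q i -> P (F i)) -> P (\sum_(i <- r | Q i) F i).
Proof.
by move=> sP PF; apply: big_ind => // [|*]; [case: sP | apply: subspaceD].
Qed.

Lemma subspace_lcomb V (P : V -> Prop) k (v : 'I_k -> V) c :
  subspace P -> (forall i, P (v i)) -> P (lcomb v c).
Proof. by move=> sP Pv; apply: subspace_sum => // i _; apply: subspaceZ. Qed.

Lemma lcombD V k (v : 'I_k -> V) c d : lcomb v (c + d) = lcomb v c + lcomb v d.
Proof.
rewrite -big_split; apply: eq_bigr => i _ /=.
by rewrite mxE mpolyCD scalerDl.
Qed.

Lemma lcombZ V k (v : 'I_k -> V) a c :
  lcomb v (a *: c) = a%:MP *: lcomb v c.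
Proof.
rewrite scaler_sumr; apply: eq_bigr => i _ /=.
by rewrite mxE mpolyCM scalerA.
Qed.

Lemma lcomb0 V k (v : 'I_k -> V) : lcomb v 0 = 0.
Proof. by rewrite /lcomb big1 // => i _; rewrite mxE mpolyC0 scale0r. Qed.

Lemma lcombB V k (v : 'I_k -> V) c d : lcomb v (c - d) = lcomb v c - lcomb v d.
Proof.
by rewrite lcombD -[- d]scaleN1r lcombZ mpolyCN mpolyC1 scaleN1r.
Qed.

Lemma lcomb_delta V k (v : 'I_k -> V) i : lcomb v (delta_mx 0 i) = v i.
Proof.
rewrite /lcomb (bigD1 i) //= mxE !eqxx mpolyC1 scale1r big1 ?addr0 // => j ne.
by rewrite mxE (negPf ne) andbF mpolyC0 scale0r.
Qed.

Lemma lcombM V k m (v : 'I_k -> V) (a : 'rV_m) (C : 'M_(m, k)) :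
  lcomb v (a *m C) = lcomb (fun i => lcomb v (row i C)) a.
Proof.
rewrite mulmx_sum_row [RHS]/lcomb.
elim/big_rec2: _ => [|i y z _ <-]; first by rewrite lcomb0.
by rewrite lcombD lcombZ.
Qed.

Lemma lcombB_fun V k (v w : 'I_k -> V) c :
  lcomb v c - lcomb w c = lcomb (fun i => v i - w i) c.
Proof. by rewrite -sumrB; apply: eq_bigr => i _; rewrite scalerBr. Qed.

(** A row of the left kernel of the coordinate matrix would be a relation among the [v i] modulo B.
    Besides uniqueness of dimensions this serves the rank comparison of two linear forms. *)
Lemma independent_coordinates V (B : V -> Prop) k m (v : 'I_k -> V)
    (w : 'I_m -> V) :
  subspace B ->
  (forall i, exists c, B (v i - lcomb w c)) ->
  (forall c, B (lcomb v c) -> c = 0) ->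
  exists2 C : 'M_(k, m), row_free C & forall c, B (lcomb v c - lcomb w (c *m C)).
Proof.
move=> sB /fin_all_exists [f fP] vfree; exists (\matrix_i f i); last first.
  move=> c; rewrite lcombM lcombB_fun; apply: subspace_lcomb => // i.
  by rewrite rowK.
rewrite -kermx_eq0; apply/eqP/row_matrixP => i; rewrite row0; apply: vfree.
have : B (lcomb v (row i (kermx (\matrix_i f i))) -
          lcomb w (row i (kermx (\matrix_i f i)) *m \matrix_i f i)).
  rewrite lcombM lcombB_fun; apply: subspace_lcomb => // j.
  by rewrite rowK.
by rewrite -row_mul mulmx_ker row0 lcomb0 subr0.
Qed.

Lemma quot_dim_uniq V (Z B : V -> Prop) k m :
  subspace B -> quot_dim Z B k -> quot_dim Z B m -> k = m.
Proof.
move=> sB; wlog suff le : k m / quot_dim Z B k -> quot_dim Z B m -> (k <= m)%N.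
  by move=> dk dm; apply/eqP; rewrite eqn_leq !le.
move=> [v [Zv _ fv]] [w [_ sw _]].
have [|C freeC _] := @independent_coordinates V B k m v w sB _ fv.
  by move=> i; apply: sw.
by rewrite -(eqP freeC) rank_leq_col.
Qed.

Lemma quot_dim_eq0 V (Z B : V -> Prop) k :
  quot_dim Z B k -> k = 0%N <-> forall z, Z z -> B z.
Proof.
move=> [v [Zv sv fv]]; split=> [k0 z /sv [c]|ZB].
  by rewrite /lcomb big1 ?subr0 // => i _; have := ltn_ord i; rewrite {2}k0.
apply/eqP; rewrite -leqn0 leqNgt; apply/negP => k_gt0.
have /fv/rowP/(_ (Ordinal k_gt0)) : B (lcomb v (delta_mx 0 (Ordinal k_gt0))).
  by rewrite lcomb_delta; apply: ZB.
by rewrite !mxE !eqxx => /eqP; rewrite oner_eq0.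
Qed.

(* The isomorphism of subquotients is given by a linear relation rho, so that
   a zigzag can be used without choosing representatives. *)
Lemma quot_dim_iso V W (Z B : V -> Prop) (Z' B' : W -> Prop)
    (rho : V -> W -> Prop) k :
  rho 0 0 ->
  (forall c z1 z1' z2 z2', rho z1 z1' -> rho z2 z2' ->
     rho (c%:MP *: z1 + z2) (c%:MP *: z1' + z2')) ->
  (forall z, Z z -> exists2 z', Z' z' & rho z z') ->
  (forall z', Z' z' -> exists2 z, Z z & rho z z') ->
  (forall z z', rho z z' -> B z <-> B' z') ->
  quot_dim Z B k -> quot_dim Z' B' k.
Proof.
move=> rho0 rhoL tot onto rhoB [v [Zv sv fv]].
have /fin_all_exists [v' v'P] i : exists z', Z' z' /\ rho (v i) z'.
  by have [z' Zz' r] := tot _ (Zv i); exists z'.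
have rho_lcomb c : rho (lcomb v c) (lcomb v' c).
  rewrite /lcomb; elim/big_rec2: _ => // i y z _ r.
  by apply: rhoL => //; case: (v'P i).
exists v'; split=> [i|z' /onto [z Zz r]|c /(rhoB _ _ (rho_lcomb c)) /fv //].
  by case: (v'P i).
have [c Bc] := sv z Zz; exists c; apply/(rhoB (z - lcomb v c)) => //.
by rewrite ![_ - lcomb _ _]addrC !oppr_scale; apply: rhoL.
Qed.

Lemma mx_quot_basis k m1 m2 (A : 'M[K]_(m1, k)) (B : 'M[K]_(m2, k)) :
  (B <= A)%MS ->
  exists W : 'M[K]_((\rank A - \rank B)%N, k),
    [/\ (W <= A)%MS,
        forall c : 'rV_k, (c <= A)%MS -> exists a, (c - a *m W <= B)%MS &
        forall a : 'rV_ _, (a *m W <= B)%MS -> a = 0].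
Proof.
move=> sBA; have <- : \rank (A :\: B)%MS = (\rank A - \rank B)%N.
  by rewrite -(mxrank_cap_compl A B) (capmx_idPr sBA) addKn.
exists (row_base (A :\: B)%MS); split.
- by rewrite eq_row_base diffmxSl.
- move=> c; rewrite -(addsmx_diff_cap_eq A B) => /sub_addsmxP [[u1 u2] /= ->].
  have /submxP [a ->] : (u1 *m (A :\: B) <= row_base (A :\: B))%MS.
    by rewrite eq_row_base submxMl.
  exists a; rewrite addrC addKr.
  exact: submx_trans (submxMl _ _) (capmxSr _ _).
- move=> a aB; have : (a *m row_base (A :\: B)%MS <= (A :\: B) :&: B)%MS.
    rewrite sub_capmx aB andbT.
    by apply: submx_trans (submxMl _ _) _; rewrite eq_row_base.
  rewrite capmx_diff submx0 => /eqP aW0.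
  by apply: (row_free_inj (row_base_free (A :\: B)%MS)); rewrite mul0mx.
Qed.

(** U is an arbitrary predicate, so its row space is found classically: as long as some vector of U
    lies outside the span, it is adjoined; [m] bounds the codimension still available. *)
Lemma subspace_rowsP k (U : 'rV[K]_k -> Prop) :
  U 0 -> (forall a u v, U u -> U v -> U (a *: u + v)) ->
  exists A : 'M[K]_k, forall u, U u <-> (u <= A)%MS.
Proof.
move=> U0 UL.
have grow m : forall A : 'M[K]_k, (k - \rank A <= m)%N ->
    (forall u : 'rV_k, (u <= A)%MS -> U u) ->
    exists A : 'M[K]_k, forall u, U u <-> (u <= A)%MS.
  elim: m => [|m IH] A rkA AU.
    exists A => u; split=> [_|/AU //]; apply: submx_full.
    by rewrite /row_full eqn_leq rank_leq_col -subn_eq0 -leqn0.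
  have [[u [Uu uA]]|noU] := classic (exists u, U u /\ ~~ (u <= A)%MS); last first.
    exists A => u; split=> [Uu|/AU //]; apply/negPn/negP => uA.
    by apply: noU; exists u.
  apply: (IH (A + u)%MS) => [|w].
    have := ltmxErank A (A + u)%MS; rewrite addsmxSl /= => lt.
    have : (A < A + u)%MS.
      rewrite ltmxE addsmxSl; apply: contra uA; apply: submx_trans.
      exact: addsmxSr.
    rewrite lt; move: rkA; lia.
  move=> /sub_addsmxP [[a b] /= ->]; rewrite addrC.
  have [b0 ->] : exists b0, b = b0%:M by exists (b 0 0); apply: mx11_scalar.
  by rewrite mul_scalar_mx; apply: UL => //; apply: AU; apply: submxMl.
apply: (grow k 0) => [|u]; first exact: leq_subr.
by rewrite submx0 => /eqP ->.
Qed.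

(** A basis of Z/B identifies it with [K^k], where B' becomes a row space A; bases of A and of a
    complement give the two parts. Finiteness of the dimension thus passes to B'/B and Z/B'. *)
Lemma quot_dim_split V (Z B B' : V -> Prop) k :
  subspace Z -> subspace B -> subspace B' ->
  (forall z, B z -> B' z) -> (forall z, B' z -> Z z) ->
  quot_dim Z B k ->
  exists k1 k2, [/\ k = (k1 + k2)%N, quot_dim B' B k1 & quot_dim Z B' k2].
Proof.
move=> sZ sB sB' BB' B'Z [v [Zv sv fv]].
have [||A AP] := @subspace_rowsP k (fun c => B' (lcomb v c)).
- by rewrite lcomb0; case: sB'.
- by move=> a u w Bu Bw; rewrite lcombD lcombZ; case: sB' => _; apply.
have [W1 [W1A sW1 fW1]] := mx_quot_basis (sub0mx k A).
have [W2 [W2A sW2 fW2]] := mx_quot_basis (submx1 A).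
exists (\rank A - \rank (0%R : 'M[K]_k))%N, (\rank (1%:M%R : 'M[K]_k) - \rank A)%N.
have rowle m1 m2 (C : 'M[K]_(m1, k)) (D : 'M[K]_(m2, k)) i :
  (C <= D)%MS -> (row i C <= D)%MS by apply: submx_trans; apply: row_sub.
split.
- by rewrite mxrank0 subn0 mxrank1 subnKC // rank_leq_col.
- exists (fun i => lcomb v (row i W1)); split.
  + by move=> i; apply/AP/rowle.
  + move=> z B'z; have [c Bc] := sv z (B'Z _ B'z).
    have /AP/sW1 [a] : B' (lcomb v c).
      rewrite -[lcomb v c](subKr z); apply: subspaceB => //.
      exact: BB'.
    rewrite submx0 subr_eq0 => /eqP ca; exists a.
    by rewrite -lcombM -ca.
  + move=> a; rewrite -lcombM => Ba; apply: fW1.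
    by rewrite submx0; apply/eqP/fv.
- exists (fun i => lcomb v (row i W2)); split.
  + by move=> i; apply: subspace_lcomb.
  + move=> z Zz; have [c Bc] := sv z Zz.
    have [a /AP] := sW2 c (submx1 c); rewrite lcombB lcombM => Ba; exists a.
    by rewrite -[z](subrK (lcomb v c)) -addrA; apply: subspaceD => //; apply: BB'.
  + by move=> a; rewrite -lcombM => /AP; apply: fW2.
Qed.

End QuotientDimension.

(** * Koszul complexes of graded submodules *)

(** The exponent of the sign that sorts [i] into its place in the wedge product of e_i and e_S. *)
Definition koszul_sign (q : nat) (i : 'I_q) (S : {set 'I_q}) : nat :=
  #|[set j in S | (j < i)%N]|.

Lemma koszul_signU q (i j : 'I_q) (S : {set 'I_q}) : j \notin S ->
  koszul_sign i (j |: S) = ((j < i) + koszul_sign i S)%N.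
Proof.
move=> jS; rewrite /koszul_sign; case ji: (j < i)%N.
  have -> : [set k in j |: S | (k < i)%N] = j |: [set k in S | (k < i)%N].
    apply/setP => k; rewrite !inE andb_orl; congr (_ || _).
    by have [->|//] := eqVneq; rewrite ji.
  by rewrite cardsU1 !inE (negPf jS).
congr #|pred_of_set _|; apply/setP => k; rewrite !inE andb_orl.
by have [->|//] := eqVneq; rewrite ji (negPf jS).
Qed.

Section Koszul.
Variables (K : fieldType) (n q : nat) (y : 'I_q -> {mpoly K[n]}).
Implicit Types (V W : lmodType {mpoly K[n]}).

(** Contraction by y in all exterior degrees at once, with [z S] as the coefficient of the basis
    vector e_S. *)
Definition koszul V (z : {ffun {set 'I_q} -> V}) : {ffun {set 'I_q} -> V} :=
  [ffun S : {set 'I_q} => \sum_(i | i \notin S)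
               ((-1) ^+ koszul_sign i S * y i) *: z (i |: S)].

Lemma koszul_is_linear V : linear (@koszul V).
Proof.
move=> a u v; apply/ffunP => S; rewrite !ffunE scaler_sumr -big_split /=.
apply: eq_bigr => i _; rewrite !ffunE scalerDr !scalerA.
by congr (_ *: _ + _); rewrite mulrC.
Qed.

HB.instance Definition _ V :=
  GRing.isLinear.Build {mpoly K[n]} {ffun {set 'I_q} -> V}
    {ffun {set 'I_q} -> V} _ (@koszul V) (@koszul_is_linear V).

(** Removing i and j in the two possible orders gives opposite signs: the smaller index counts in
    the sign of the larger one in one order only. *)
Lemma koszulK V (z : {ffun {set 'I_q} -> V}) : koszul (koszul z) = 0.
Proof.
apply/ffunP => S; rewrite !ffunE.
pose F (i j : 'I_q) :=
  ((-1) ^+ koszul_sign i S * y i * ((-1) ^+ koszul_sign j (i |: S) * y j))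
    *: z (j |: (i |: S)).
transitivity (\sum_(i | i \notin S) \sum_(j | (j \notin S) && (j != i)) F i j).
  apply: eq_bigr => i _; rewrite ffunE scaler_sumr; apply: eq_big => j.
    by rewrite !inE negb_or andbC.
  by rewrite scalerA.
have FN (i j : 'I_q) : i \notin S -> j \notin S -> (i < j)%N -> F i j + F j i = 0.
  move=> iS jS ij; rewrite /F setUCA -scalerDl !koszul_signU // ij.
  rewrite [(j < i)%N]ltnNge ltnW //= add0n add1n exprS.
  by rewrite [X in X *: _](_ : _ = 0) ?scale0r //; ring.
rewrite (eq_bigr (fun i : 'I_q => \sum_(j | (j \notin S) && (i < j)%N) F i j +
    \sum_(j | (j \notin S) && (j < i)%N) F i j)); last first.
  move=> i _; rewrite (bigID (fun j : 'I_q => (i < j)%N)) /=.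
  by congr (_ + _); apply: eq_bigl => j;
    rewrite -(inj_eq val_inj) -andbA; congr (_ && _) => /=; lia.
rewrite big_split /= [X in _ + X]
  (exchange_big_dep (fun j => j \notin S)) //=; last by move=> i j _ /andP [].
rewrite -big_split big1 // => i iS /=.
rewrite [X in _ + X](eq_bigl (fun j : 'I_q => (j \notin S) && (i < j)%N)).
  by rewrite -big_split big1 // => j /andP [jS ij]; apply: FN.
by move=> j; rewrite iS.
Qed.

Definition cmap V W (phi : V -> W) (z : {ffun {set 'I_q} -> V}) :
  {ffun {set 'I_q} -> W} := [ffun S => phi (z S)].

Lemma cmap_is_linear V W (phi : {linear V -> W}) : linear (cmap phi).
Proof. by move=> a u v; apply/ffunP => S; rewrite !ffunE linearP. Qed.

HB.instance Definition _ V W (phi : {linear V -> W}) :=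
  GRing.isLinear.Build {mpoly K[n]} {ffun {set 'I_q} -> V}
    {ffun {set 'I_q} -> W} _ (cmap phi) (cmap_is_linear phi).

Lemma koszul_cmap V W (phi : {linear V -> W}) z :
  koszul (cmap phi z) = cmap phi (koszul z).
Proof.
apply/ffunP => S; rewrite !ffunE linear_sum; apply: eq_bigr => i _.
by rewrite linearZ ffunE.
Qed.

Definition graded_submod V (M : int -> V -> Prop) : Prop :=
  (forall e, subspace (M e)) /\
  forall e l v, l \is 1.-homog for mdeg -> M e v -> M (e + 1) (l *: v).

Definition chain V (M : int -> V -> Prop) (p : nat) (e : int)
    (z : {ffun {set 'I_q} -> V}) : Prop :=
  forall S, M e (z S) /\ (#|S| != p -> z S = 0).

Lemma subspace_chain V (M : int -> V -> Prop) p e :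
  subspace (M e) -> subspace (chain M p e).
Proof.
move=> sM; split=> [S|c u v uC vC S]; first by rewrite ffunE; split=> //; case: sM.
have [[Mu u0] [Mv v0]] := (uC S, vC S); rewrite !ffunE; split.
  by case: sM => _; apply.
by move=> Sp; rewrite u0 // v0 // scaler0 addr0.
Qed.

Lemma chain0 V (M : int -> V -> Prop) p e :
  subspace (M e) -> chain M p e 0.
Proof. by move=> sM; apply: (subspace0 (subspace_chain p sM)). Qed.

Lemma chainD V (M : int -> V -> Prop) p e z1 z2 : subspace (M e) ->
  chain M p e z1 -> chain M p e z2 -> chain M p e (z1 + z2).
Proof. by move=> sM; apply: (subspaceD (subspace_chain p sM)). Qed.

Lemma chainB V (M : int -> V -> Prop) p e z1 z2 : subspace (M e) ->
  chain M p e z1 -> chain M p e z2 -> chain M p e (z1 - z2).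
Proof. by move=> sM; apply: (subspaceB (subspace_chain p sM)). Qed.

Lemma chainN V (M : int -> V -> Prop) p e z :
  subspace (M e) -> chain M p e z -> chain M p e (- z).
Proof. by move=> sM; apply: (subspaceN (subspace_chain p sM)). Qed.

Lemma chain_sub V (M N : int -> V -> Prop) p e z :
  (forall v, M e v -> N e v) -> chain M p e z -> chain N p e z.
Proof. by move=> MN zC S; have [Mz z0] := zC S; split=> //; apply: MN. Qed.

Lemma chain_cmap V W (M : int -> V -> Prop) (N : int -> W -> Prop)
    (phi : {linear V -> W}) p e z :
  (forall v, M e v -> N e (phi v)) -> chain M p e z -> chain N p e (cmap phi z).
Proof.
move=> MN zC S; have [Mz z0] := zC S; rewrite ffunE; split; first exact: MN.
by move=> /z0 ->; rewrite linear0.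
Qed.

Lemma chain_choice V (Q : {set 'I_q} -> V -> Prop) p :
  (forall S : {set 'I_q}, #|S| = p -> exists v, Q S v) ->
  exists z : {ffun {set 'I_q} -> V},
    forall S : {set 'I_q}, (#|S| = p -> Q S (z S)) /\ (#|S| != p -> z S = 0).
Proof.
move=> ex.
have /fin_all_exists [f fP] (S : {set 'I_q}) :
    exists v, (#|S| = p -> Q S v) /\ (#|S| != p -> v = 0).
  have [/ex [v Qv]|ne] := eqVneq #|S| p; first by exists v; split.
  by exists 0; split=> // /eqP; rewrite (negPf ne).
by exists [ffun S => f S] => S; rewrite ffunE.
Qed.

Lemma chain_lift V W (G : int -> V -> Prop) (M : int -> W -> Prop)
    (phi : {linear V -> W}) p e z :
  subspace (G e) -> (forall w, M e w -> exists2 v, G e v & phi v = w) ->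
  chain M p e z -> exists2 f, chain G p e f & cmap phi f = z.
Proof.
move=> sG lift zC.
have [|f fP] := @chain_choice V (fun S v => G e v /\ phi v = z S) p.
  by move=> S _; have [Mz _] := zC S; have [v Gv <-] := lift _ Mz; exists v.
exists f => [S|]; last apply/ffunP => S; have [fS f0] := fP S.
  have [/fS [] //|/f0 fS0] := eqVneq #|S| p.
  by rewrite fS0; split=> //; case: sG.
rewrite ffunE; have [/fS [] //|ne] := eqVneq #|S| p.
by rewrite f0 // linear0; have [_ ->] := zC S.
Qed.

Variable x : {mpoly K[n]}.
Hypothesis x_lin : x \is 1.-homog for mdeg.
Hypothesis y_lin : forall i, y i \is 1.-homog for mdeg.

Lemma koszul_chain V (M : int -> V -> Prop) p e z :
  graded_submod M -> chain M p.+1 e z -> chain M p (e + 1) (koszul z).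
Proof.
move=> [sM gM] zC S; rewrite ffunE; split=> [|Sp].
  apply: subspace_sum => // i _; apply: gM; last by have [] := zC (i |: S).
  rewrite -signr_odd; case: odd; rewrite ?expr1 ?expr0 ?mul1r ?mulN1r //.
  by rewrite rpredN.
rewrite big1 // => i iS; have [_ ->] := zC (i |: S); first by rewrite scaler0.
by rewrite cardsU1 iS add1n eqSS.
Qed.

Lemma koszul_chain0 V (M : int -> V -> Prop) e z :
  chain M 0 e z -> koszul z = 0.
Proof.
move=> zC; apply/ffunP => S; rewrite !ffunE big1 // => i iS.
by have [_ ->] := zC (i |: S); rewrite ?scaler0 // cardsU1 iS.
Qed.

Lemma chain_scale V (M : int -> V -> Prop) p e z :
  graded_submod M -> chain M p e z -> chain M p (e + 1) (x *: z).
Proof.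
move=> [sM gM] zC S; have [Mz z0] := zC S; rewrite ffunE; split.
  exact: gM.
by move=> /z0 ->; rewrite scaler0.
Qed.

(* Cycles and boundaries of the Koszul complex of M/xM in homological degree p,
   for coefficients of degree e (total degree p + e). In kboundary the multiples
   of x are taken in P, so that P = R gives the complex of the image of M
   modulo x. *)
Definition kcycle V (M : int -> V -> Prop) (p : nat) (e : int)
    (z : {ffun {set 'I_q} -> V}) : Prop :=
  chain M p e z /\ exists2 t, chain M p.-1 e t & koszul z = x *: t.

Definition kboundary V (M P : int -> V -> Prop) (p : nat) (e : int)
    (z : {ffun {set 'I_q} -> V}) : Prop :=
  exists w t, [/\ chain M p.+1 (e - 1) w, chain P p (e - 1) t &
                  z = koszul w + x *: t].

Lemma subspace_kcycle V (M : int -> V -> Prop) p e :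
  subspace (M e) -> subspace (kcycle M p e).
Proof.
move=> sM; have [c0 cL] := subspace_chain p sM.
have [c0' cL'] := subspace_chain p.-1 sM.
split=> [|c u v [uC [t tC ut]] [vC [s sC vs]]].
  by split=> //; exists 0; rewrite ?linear0 ?scaler0.
split; first exact: cL.
exists (c%:MP *: t + s); first exact: cL'.
by rewrite linearP /= ut vs scalerDr !scalerA [x * _]mulrC.
Qed.

Lemma subspace_kboundary V (M P : int -> V -> Prop) p e :
  subspace (M (e - 1)) -> subspace (P (e - 1)) -> subspace (kboundary M P p e).
Proof.
move=> sM sP; have [c0 cL] := subspace_chain p.+1 sM.
have [d0 dL] := subspace_chain p sP.
split=> [|c _ _ [w [t [wC tC ->]]] [w' [t' [wC' tC' ->]]]].
  by exists 0, 0; split; rewrite // linear0 scaler0 addr0.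
exists (c%:MP *: w + w'), (c%:MP *: t + t').
split; [exact: cL | exact: dL |].
rewrite linearP /= !scalerDr !scalerA [x * _]mulrC.
by rewrite addrACA.
Qed.

Lemma koszulZ V (t : {ffun {set 'I_q} -> V}) : koszul (x *: t) = x *: koszul t.
Proof. exact: linearZ. Qed.

Lemma kboundary_chain V (M : int -> V -> Prop) p e z :
  graded_submod M -> kboundary M M p e z -> chain M p e z.
Proof.
move=> gM [w [t [wC tC ->]]]; have sM := gM.1 e.
apply: chainD => //.
  by rewrite -[e](subrK 1); apply: koszul_chain.
by rewrite -[e](subrK 1); apply: chain_scale.
Qed.

(* The connecting isomorphism for 0 -> N/xN -> G/xG -> M/xM -> 0. *)
Lemma koszul_shift V W (G : int -> V -> Prop) (M : int -> W -> Prop)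
    (phi : {linear V -> W}) (N := fun e v => G e v /\ phi v = 0) p e k :
  graded_submod G -> graded_submod M ->
  (forall e w, M e w <-> exists2 v, G e v & phi v = w) ->
  (forall w : W, x *: w = 0 -> w = 0) ->
  (forall z, kcycle G p.+1 e z -> kboundary G G p.+1 e z) ->
  quot_dim (fun z => kcycle N p (e + 1) z /\ kboundary G G p (e + 1) z)
    (kboundary N N p (e + 1)) k ->
  quot_dim (kcycle M p.+1 e) (kboundary M M p.+1 e) k.
Proof.
move=> gG gM imphi xreg exG.
have xregc (u : {ffun {set 'I_q} -> W}) : x *: u = 0 -> u = 0.
  by move=> /ffunP xu; apply/ffunP => S; have := xu S; rewrite !ffunE => /xreg.
have [sG mG] := gG; have [sM mM] := gM.
have kerC j d z : chain N j d z <-> chain G j d z /\ cmap phi z = 0.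
  split=> [zC|[zC z0] S].
    split; first by apply: chain_sub zC => v [].
    by apply/ffunP => S; rewrite !ffunE; have [[]] := zC S.
  have [Gz zS] := zC S; split=> //; split=> //.
  by move/ffunP/(_ S): z0; rewrite !ffunE.
have liftM j d z : chain M j d z -> exists2 f, chain G j d f & cmap phi f = z.
  by apply: chain_lift => // w /imphi.
have pushM j d z : chain G j d z -> chain M j d (cmap phi z).
  by apply: chain_cmap => v Gv; apply/imphi; exists v.
(* [z'] is a connecting image of [z]: lift [z] to [f], lift the quotient of its differential by x to
   [u], and the defect [koszul f - x *: u] falls into the kernel N. A relation avoids choosing the
   lifts. *)
apply: (@quot_dim_iso _ _ _ _ _ _ _ _ (fun z' z =>
  exists f u, [/\ chain G p.+1 e f, chain G p e u, cmap phi f = z,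
    z' = koszul f - x *: u & cmap phi z' = 0])).
- exists 0, 0; rewrite !linear0 addr0.
  by split=> //; apply: chain0.
- move=> c z1' z1 z2' z2 [f1 [u1 [f1C u1C <- -> h1]]] [f2 [u2 [f2C u2C <- -> h2]]].
  exists (c%:MP *: f1 + f2), (c%:MP *: u1 + u2); split.
  + by have [_] := subspace_chain p.+1 (sG e); apply.
  + by have [_] := subspace_chain p (sG e); apply.
  + by rewrite linearP.
  + rewrite linearP /= scalerBr scalerDr opprD addrACA !scalerA.
    by rewrite [x * _]mulrC.
  + by rewrite linearP /= h1 h2 scaler0 addr0.
- move=> z' [[/kerC [zC z0] _] [f [t [fC tC zE]]]].
  move: fC tC; rewrite addrK => fC tC.
  have fE : z' = koszul f - x *: - t by rewrite scalerN opprK.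
  exists (cmap phi f).
    split; first exact: pushM.
    exists (- cmap phi t); first by rewrite -linearN; apply: pushM;
      apply: chainN.
    rewrite koszul_cmap; apply/eqP; rewrite -subr_eq0 scalerN opprK; apply/eqP.
    by rewrite -linearZ -linearD -zE.
  exists f, (- t); split=> //.
  by apply: chainN.
- move=> z [zC [t tC zt]]; have [f fC fz] := liftM _ _ _ zC.
  have [u uC ut] := liftM _ _ _ tC.
  pose z' := koszul f - x *: u.
  have z'0 : cmap phi z' = 0.
    by rewrite linearB linearZ /= -koszul_cmap fz ut zt subrr.
  have z'N : chain N p (e + 1) z'.
    apply/kerC; split=> //; apply: chainB => //.
      exact: koszul_chain.
    exact: chain_scale.
  exists z'; last by exists f, u.
  split; last first.
    exists f, (- u); rewrite addrK; split=> //; last by rewrite scalerN.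
    by apply: chainN.
  (* The differential of [z'] is [- (x *: koszul u)]; its image under [phi] vanishes, and x can be
     cancelled in W. *)
  split=> //; exists (- koszul u); last first.
    by rewrite linearB /= koszulK sub0r koszulZ scalerN.
  apply/kerC; split; last first.
    apply: xregc; rewrite -linearZ /= scalerN -koszulZ -[X in cmap _ X]add0r.
    rewrite -[X in cmap _ (X + _)](koszulK f) -linearB /=.
    by rewrite -koszul_cmap z'0 linear0.
  apply: chainN => //.
  case: (p) uC => [|p'] uC; last exact: koszul_chain.
  by rewrite (koszul_chain0 uC); apply: chain0.
- move=> z' z [f [u [fC uC <- z'E z'0]]]; split.
    (* [f - m] is a cycle of G modulo x, hence a boundary there, and it still maps to [z]. *)
    move=> [m [v []]]; rewrite addrK => /kerC [mC m0] /kerC [vC v0] z'mv.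
    have kfm : koszul (f - m) = x *: (u + v).
      rewrite linearB /= scalerDr; apply/eqP; rewrite subr_eq.
      by rewrite -[koszul f](subrK (x *: u)) -z'E z'mv addrC [koszul m + _]addrC addrA.
    have [|g [t [gC tC gt]]] := exG (f - m).
      split; first by apply: chainB.
      by exists (u + v) => //; apply: chainD.
    exists (cmap phi g), (cmap phi t); split; [exact: pushM|exact: pushM|].
    by rewrite koszul_cmap -linearZ -linearD -gt linearB /= m0 subr0.
  move=> [w [t [wC tC fwt]]].
  have [w' wC' wE] := liftM _ _ _ wC; have [t' tC' tE] := liftM _ _ _ tC.
  (* Removing the lifted boundary from [f] leaves an element of N whose differential is [z'] modulo
     x. *)
  pose m := f - koszul w' - x *: t'.
  have m0 : cmap phi m = 0.
    by rewrite !linearB linearZ /= -koszul_cmap wE tE fwt -addrA -opprD subrr.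
  have mC : chain G p.+1 e m.
    apply: chainB => //; last first.
      by rewrite -[e](subrK 1); apply: chain_scale.
    apply: chainB => //.
    by rewrite -[e](subrK 1); apply: koszul_chain.
  have z'mt : z' = koszul m + x *: (koszul t' - u).
    rewrite z'E /m !linearB /= koszulK subr0 koszulZ addrA.
    by rewrite subrK.
  exists m, (koszul t' - u); rewrite addrK; split=> //; apply/kerC; split=> //.
    apply: chainB => //.
    by rewrite -[e](subrK 1); apply: koszul_chain.
  apply: xregc; rewrite -linearZ /= -[_ *: _](addKr (koszul m)) -z'mt.
  by rewrite linearD linearN /= -koszul_cmap m0 z'0 linear0 oppr0 addr0.
Qed.

End Koszul.

(** * Polynomial rings modulo a linear form *)

Section Homogeneous.
Variables (K : fieldType) (n : nat).
Implicit Types (p r : {mpoly K[n]}) (m : 'X_{1..n}).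

Definition zhomog (e : int) p : Prop := shifted_homog 0 e p.

Lemma zhomogP e p : zhomog e p <-> forall m, p@_m != 0 -> (mdeg m)%:Z = e.
Proof.
rewrite /zhomog /shifted_homog subr0; case: e => e; split.
- move=> hp m; apply: contraNeq => ne; apply/eqP.
  by apply: (dhomog_nemf_coeff hp); apply: contraNneq ne => ->.
- by move=> hp; apply/dhomogP => m; rewrite mcoeff_msupp => /hp [].
- by move=> -> m; rewrite mcoeff0 eqxx.
- by move=> hp; apply/mpolyP => m; rewrite mcoeff0; apply/eqP/negPn/negP => /hp.
Qed.

Lemma zhomog_nat (e : nat) p : zhomog e%:Z p <-> p \is e.-homog for mdeg.
Proof. by rewrite /zhomog /shifted_homog subr0. Qed.

Lemma shifted_homogE a j p : shifted_homog a j p = zhomog (j - a) p.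
Proof. by rewrite /zhomog /shifted_homog subr0. Qed.

Lemma zhomog0 e : zhomog e (0 : {mpoly K[n]}).
Proof. by apply/zhomogP => m; rewrite mcoeff0 eqxx. Qed.

Lemma zhomogD e p r : zhomog e p -> zhomog e r -> zhomog e (p + r).
Proof.
move=> /zhomogP hp /zhomogP hr; apply/zhomogP => m; rewrite mcoeffD.
by have [->|/hp //] := eqVneq p@_m 0; rewrite add0r; apply: hr.
Qed.

Lemma zhomogC c : zhomog 0 (c%:MP_[n]).
Proof.
apply/zhomogP => m; rewrite mcoeffC; have [->|] := eqVneq m 0%MM.
  by rewrite mdeg0.
by rewrite mulr0 eqxx.
Qed.

Lemma zhomogM a b p r : zhomog a p -> zhomog b r -> zhomog (a + b) (p * r).
Proof.
case: a => [a|a]; last first.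
  by rewrite {1}/zhomog /shifted_homog subr0 => ->; rewrite mul0r => _; apply: zhomog0.
case: b => [b|b]; last first.
  by rewrite {2}/zhomog /shifted_homog subr0 => _ ->; rewrite mulr0; apply: zhomog0.
by rewrite -PoszD => /zhomog_nat hp /zhomog_nat hr; apply/zhomog_nat/dhomogM.
Qed.

Definition zcomp (e : int) p : {mpoly K[n]} :=
  if e is Posz d then pihomog mdeg d p else 0.

Lemma zcomp_zhomog e p : zhomog e (zcomp e p).
Proof. by case: e => e; [apply/zhomog_nat/pihomogP|apply: zhomog0]. Qed.

Lemma zcomp_is_linear e : linear (zcomp e).
Proof.
by case: e => e a p r; rewrite /zcomp ?linearP // scaler0 addr0.
Qed.

HB.instance Definition _ e :=
  GRing.isLinear.Build K {mpoly K[n]} {mpoly K[n]} _ (zcomp e)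
    (zcomp_is_linear e).

Lemma zcompE a e p : zhomog a p -> zcomp e p = if a == e then p else 0.
Proof.
case: e => e ap; last first.
  rewrite /zcomp; case: eqP => // ae; move: ap.
  by rewrite ae /zhomog /shifted_homog subr0.
case: a ap => a ap /=.
  rewrite (_ : (Posz a == Posz e) = (a == e)) //.
  have [ae|ne] := eqVneq; first by apply/pihomog_dE; rewrite -ae; apply/zhomog_nat.
  by apply: (pihomog_ne0 ne); apply/zhomog_nat.
by move: ap; rewrite /zhomog /shifted_homog subr0 => ->; rewrite pihomog0 ?if_same.
Qed.

Lemma zhomogX m : zhomog (mdeg m)%:Z ('X_[m] : {mpoly K[n]}).
Proof. by apply/zhomog_nat; rewrite dhomogX. Qed.

Lemma zhomogZ e c p : zhomog e p -> zhomog e (c *: p).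
Proof. by move=> hp; rewrite -mul_mpolyC -[e]add0r; apply: zhomogM => //; apply: zhomogC. Qed.

Lemma zcompM e b p r : zhomog b r -> zcomp (e + b) (p * r) = zcomp e p * r.
Proof.
move=> hr; rewrite [p]mpolyE mulr_suml !linear_sum mulr_suml /=.
apply: eq_bigr => m _.
have hm : zhomog (mdeg m)%:Z (p@_m *: 'X_[m]) by apply: zhomogZ; apply: zhomogX.
rewrite (zcompE _ hm) (zcompE _ (zhomogM hm hr)).
by rewrite (inj_eq (addIr b)); case: eqP; rewrite ?mul0r.
Qed.

Lemma mcoeffXiM i p m :
  ('X_i * p)@_m = if (0 < m i)%N then p@_(m - U_(i)) else 0.
Proof.
rewrite mulrC; case: ifP => mi.
  have {1}-> : m = (U_(i) + (m - U_(i)))%MM.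
    apply/mnmP => j; rewrite mnmDE mnmBE mnm1E; case: eqP => [<-|_] /=; lia.
  exact: mcoeffMX.
apply/eqP; rewrite mcoeff_eq0 (perm_mem (msuppMX p U_(i)) m).
apply/negP => /mapP [m' _ mE]; move: mi; rewrite mE mnmDE mnm1E eqxx.
by rewrite add1n.
Qed.

Lemma mcoeff_signM a p m : ((-1) ^+ a * p)@_m = (-1) ^+ a * p@_m.
Proof.
rewrite -signr_odd -[in RHS]signr_odd; case: odd.
  by rewrite !expr1 !mulN1r mcoeffN.
by rewrite !expr0 !mul1r.
Qed.

Lemma max_idealP p : max_ideal p <-> p@_0%MM = 0.
Proof.
split=> [[r ->]|p0].
  rewrite linear_sum big1 // => i _ /=; rewrite rmorphM /= mcoeffX.
  by rewrite mnm1_eq0 mulr0.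
have ex m : m != 0%MM -> @max_ideal K n 'X_[m].
  move=> m0; have [i mi] : exists i, (0 < m i)%N.
    apply/existsP; apply: contraR m0; rewrite negb_exists => /forallP m0.
    by apply/eqP/mnmP => i; rewrite mnm0E; apply/eqP; rewrite -leqn0 leqNgt.
  exists (fun j => if j == i then 'X_[m - U_(i)] else 0).
  rewrite (bigD1 i) //= eqxx big1 ?addr0 => [|j /negPf ->]; last by rewrite mul0r.
  rewrite -mpolyXD; congr 'X_[_]; apply/mnmP => j.
  rewrite mnmDE mnmBE mnm1E; case: eqP => [<-|_] /=; lia.
rewrite [p]mpolyE; move/eqP: p0; rewrite mcoeff_eq0 => p0.
rewrite big_seq; elim/big_rec: _ => [|m r mp [t ->]].
  by exists (fun=> 0); rewrite big1 // => i _; rewrite mul0r.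
have [|s ->] := ex m; first by apply: contraNneq p0 => <-.
exists (fun i => p@_m *: s i + t i); rewrite scaler_sumr -big_split.
by apply: eq_bigr => i _; rewrite mulrDl scalerAl.
Qed.

Lemma sum_var_decomposition e p : p@_0%MM = 0 -> zhomog e p ->
  exists2 r : 'I_n -> {mpoly K[n]}, forall i, zhomog (e - 1) (r i) &
    p = \sum_i r i * 'X_i.
Proof.
move=> /max_idealP [r rE] hp.
exists (fun i => zcomp (e - 1) (r i)) => [i|]; first exact: zcomp_zhomog.
have := zcompE e hp; rewrite eqxx => {1}<-; rewrite {1}rE linear_sum /=.
apply: eq_bigr => i _; rewrite -(@zcompM _ 1) ?subrK //.
by have := zhomogX U_(i); rewrite mdeg1.
Qed.

End Homogeneous.

(** * Eliminating one variable by a linear form *)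

Section Regular.
Variables (K : fieldType) (q : nat) (k : 'I_q.+1) (c : 'I_q.+1 -> K).
Hypothesis ck : c k != 0.
Local Notation R := {mpoly K[q.+1]}.

Definition linform : R := \sum_i c i *: 'X_i.
Definition yvar (i : 'I_q) : R := 'X_(lift k i).

(** Solves x = 0 for ['X_k]. The resulting ring map [elim_var] kills x, fixes y and is the identity
    modulo x, so it realises R/xR inside R as the polynomials in y. *)
Definition subst_var (i : 'I_q.+1) : R :=
  if i == k then - \sum_(j < q) (c (lift k j) / c k) *: yvar j else 'X_i.

Definition elim_var : R -> R := mmap (@mpolyC q.+1 K) subst_var.

HB.instance Definition _ := GRing.RMorphism.on elim_var.

Lemma linform_homog : linform \is 1.-homog for mdeg.
Proof. by apply: rpred_sum => i _; apply: rpredZ; rewrite dhomogX /= mdeg1. Qed.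

Lemma yvar_homog i : yvar i \is 1.-homog for mdeg.
Proof. by rewrite dhomogX /= mdeg1. Qed.

Lemma linformE : linform = c k *: 'X_k + \sum_j c (lift k j) *: yvar j.
Proof. by rewrite /linform (bigD1_ord k). Qed.

Lemma elim_varC a : elim_var a%:MP = a%:MP.
Proof. exact: mmapC. Qed.

Lemma elim_varX i : elim_var 'X_i = subst_var i.
Proof. by rewrite /elim_var mmapX mmap1U. Qed.

Lemma elim_yvar j : elim_var (yvar j) = yvar j.
Proof. by rewrite elim_varX /subst_var eq_sym (negPf (neq_lift k j)). Qed.

Lemma elim_linform : elim_var linform = 0.
Proof.
rewrite linformE rmorphD rmorph_sum /= -mul_mpolyC rmorphM /= elim_varC elim_varX.
rewrite /subst_var eqxx mul_mpolyC scalerN scaler_sumr addrC; apply/eqP.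
rewrite subr_eq0; apply/eqP/eq_bigr => j _.
by rewrite -mul_mpolyC rmorphM /= elim_varC elim_yvar mul_mpolyC scalerA mulrC divfK.
Qed.

(** The identity and [elim_var] agree modulo x on constants and variables, and sums and products
    preserve the agreement. *)
Lemma sub_elim_var p : exists r, p - elim_var p = linform * r.
Proof.
pose D (p : R) := exists r, p - elim_var p = linform * r.
have DM p1 p2 : D p1 -> D p2 -> D (p1 * p2).
  move=> [r1 e1] [r2 e2]; exists (r1 * p2 + elim_var p1 * r2).
  rewrite mulrDr mulrA -e1 [linform * _]mulrCA -e2 rmorphM /= mulrBl mulrBr.
  by rewrite addrA subrK.
have DD p1 p2 : D p1 -> D p2 -> D (p1 + p2).
  move=> [r1 e1] [r2 e2]; exists (r1 + r2).
  by rewrite mulrDr -e1 -e2 rmorphD opprD addrACA.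
have DC a : D a%:MP by exists 0; rewrite elim_varC subrr mulr0.
have DX i : D 'X_i.
  rewrite /D elim_varX /subst_var; case: eqP => [->|_]; last first.
    by exists 0; rewrite subrr mulr0.
  exists (c k)^-1%:MP; rewrite mulrC mul_mpolyC linformE scalerDr scalerA mulVf //.
  rewrite scale1r opprK; congr (_ + _); rewrite scaler_sumr.
  by apply: eq_bigr => j _; rewrite scalerA mulrC.
rewrite -/(D p) [p]mpolyE; apply: (big_ind D) => [|p1 p2|m _].
- by rewrite -mpolyC0; apply: DC.
- exact: DD.
rewrite -mul_mpolyC; apply: (DM); first exact: DC.
rewrite mpolyXE_id; apply: (big_ind D) => [|p1 p2|i _].
- by rewrite -mpolyC1; apply: DC.
- exact: DM.
elim: (m i) => [|a IH]; first by rewrite expr0 -mpolyC1; apply: DC.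
by rewrite exprS; apply: (DM).
Qed.

Lemma zhomog_lin (l : R) : l \is 1.-homog for mdeg -> zhomog 1 l.
Proof. by move=> h; apply/zhomog_nat. Qed.

Lemma subst_var_homog i : zhomog 1 (subst_var i).
Proof.
apply: zhomog_lin; rewrite /subst_var; case: eqP => _; last by rewrite dhomogX /= mdeg1.
by rewrite rpredN; apply: rpred_sum => j _; apply: rpredZ; apply: yvar_homog.
Qed.

Lemma elim_var_homog e p : zhomog e p -> zhomog e (elim_var p).
Proof.
move=> /zhomogP hp; rewrite /elim_var /mmap big_seq.
apply: big_ind => [|*|m]; [exact: zhomog0 | exact: zhomogD |].
rewrite mcoeff_msupp => /hp <-; rewrite -[_%:Z]add0r; apply: zhomogM.
  exact: zhomogC.
rewrite mdegE /mmap1.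
elim/big_rec2: _ => [|i a b _ IH]; first by rewrite -mpolyC1; apply: zhomogC.
rewrite PoszD; apply: zhomogM => //.
elim: (m i) => [|d IHd]; first by rewrite expr0 -mpolyC1; apply: zhomogC.
by rewrite exprS -[d.+1]add1n PoszD; apply: zhomogM => //; apply: subst_var_homog.
Qed.

Lemma linform_neq0 : linform != 0.
Proof.
apply/eqP => /mpolyP /(_ U_(k)%MM); rewrite mcoeff0 linformE mcoeffD mcoeffZ.
rewrite mcoeffXU eqxx mulr1 linear_sum /= big1 ?addr0 => [/eqP|j _].
  by rewrite (negPf ck).
by rewrite mcoeffZ mcoeffXU eq_sym (negPf (neq_lift k j)) mulr0.
Qed.

Lemma sub_elim_var_homog e p : zhomog e p ->
  exists2 r, zhomog (e - 1) r & p - elim_var p = linform * r.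
Proof.
move=> hp; have [r pr] := sub_elim_var p.
exists (zcomp (e - 1) r); first exact: zcomp_zhomog.
have h : zhomog e (p - elim_var p).
  apply: zhomogD => //; rewrite -scaleN1r; apply: zhomogZ.
  exact: elim_var_homog.
rewrite mulrC -(@zcompM _ _ _ 1) ?subrK; last exact/zhomog_lin/linform_homog.
by rewrite mulrC -pr (zcompE _ h) eqxx.
Qed.

(** As [c k] is invertible, x can replace ['X_k] among the generators of the maximal ideal. *)
Lemma ideal_decomposition e p : p@_0%MM = 0 -> zhomog e p ->
  exists (r : 'I_q -> R) t, [/\ forall i, zhomog (e - 1) (r i),
    zhomog (e - 1) t & p = \sum_i yvar i * r i + linform * t].
Proof.
move=> p0 hp; have [r hr ->] := sum_var_decomposition p0 hp.
exists (fun j => r (lift k j) - (c (lift k j) / c k) *: r k), ((c k)^-1 *: r k).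
split=> [j||].
- by apply: zhomogD => //; rewrite -scaleNr; apply: zhomogZ.
- exact: zhomogZ.
rewrite (bigD1_ord k) //= linformE mulrDl -scalerAr -scalerAl scalerA mulVf //.
rewrite scale1r addrCA [r k * _]mulrC; congr (_ + _).
rewrite mulr_suml -big_split; apply: eq_bigr => j _ /=.
by rewrite -!mul_mpolyC mpolyCM /yvar; ring.
Qed.

End Regular.

(** * A contracting homotopy for the Koszul complex on the variables y *)

Section Exactness.
Variables (K : fieldType) (q : nat) (k : 'I_q.+1).
Local Notation R := {mpoly K[q.+1]}.
Implicit Types (S : {set 'I_q}) (m : 'X_{1..q.+1}) (z : {set 'I_q} -> R).

(* On X^m e_S the contracting homotopy divides by the first of the variables
   occurring in m or S and wedges with it, provided that it is not in S. This
   works in every characteristic. divide_var extracts the monomials whose first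
   variable is the i-th one. *)
Definition divide_var (i : 'I_q) (p : R) : R :=
  \sum_(m : 'X_{1..q.+1 < msize p})
    (if [forall j : 'I_q, (j < i)%N ==> (m (lift k j) == 0)]%N
     then p@_(m + U_(lift k i)) else 0) *: 'X_[m].

Lemma mcoeff_divide_var i p m :
  (divide_var i p)@_m =
    if [forall j : 'I_q, (j < i)%N ==> (m (lift k j) == 0)]%N
    then p@_(m + U_(lift k i)) else 0.
Proof.
pose E (m : 'X_{1..q.+1}) :=
  if [forall j : 'I_q, (j < i)%N ==> (m (lift k j) == 0)]%N
  then p@_(m + U_(lift k i)) else 0.
rewrite -/(E m) /divide_var; have [lt|le] := ltnP (mdeg m) (msize p).
  exact: (mcoeff_mpoly E).
have -> : E m = 0.
  rewrite /E; case: ifP => // _; apply/eqP; rewrite mcoeff_eq0.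
  by apply: msize_mdeg_ge; rewrite mdegD (leq_trans le) ?leq_addr.
rewrite linear_sum big1 // => m' _ /=; rewrite mcoeffZ mcoeffX.
case: eqP => [mE|]; last by rewrite mulr0.
by have := bmdeg m'; rewrite mE ltnNge le.
Qed.

Definition homotopy z S : R :=
  if [pick i in S | [forall j in S, (i <= j)%N]] is Some i
  then divide_var i (z (S :\ i)) else 0.

Definition least_var (i : 'I_q) m S : Prop :=
  (i \in S) || (0 < m (lift k i))%N /\
  forall j : 'I_q, (j < i)%N -> (j \notin S) && (m (lift k j) == 0)%N.

Lemma least_var_exists m S : S != set0 -> exists i, least_var i m S.
Proof.
move=> /set0Pn [i0 i0S].
have i0P : (i0 \in S) || (0 < m (lift k i0))%N by rewrite i0S.
have [i iP imin] := @arg_minnP _ i0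
  (fun i => (i \in S) || (0 < m (lift k i))%N) (fun i : 'I_q => i : nat) i0P.
exists i; split=> // j; apply: contraTT.
rewrite negb_and negbK -lt0n -leqNgt; exact: imin.
Qed.

(** [homotopy] takes the least element of S, and [divide_var] requires that no smaller variable
    divide the monomial; together they say that the first variable of the pair (m, S) lies in S. *)
Lemma mcoeff_homotopy z i m S : least_var i m S ->
  (homotopy z S)@_m =
    if i \in S then (z (S :\ i))@_(m + U_(lift k i)) else 0.
Proof.
move=> [iP ilt]; rewrite /homotopy; case: pickP => [j /andP [jS jmin]|none].
  rewrite mcoeff_divide_var; case: ifP => [/forallP mj|].
    suff -> : i = j by rewrite jS.
    apply/val_inj/eqP; rewrite eqn_leq /= [(i <= j)%N]leqNgt; apply/andP; split.
      by apply/negP => /ilt; rewrite jS.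
    have [iS|iS] := boolP (i \in S); first by have /forall_inP := jmin; apply.
    rewrite leqNgt; apply/negP => ij; have := implyP (mj i) ij.
    by move: iP; rewrite (negPf iS) /= lt0n => /negPf ->.
  move=> /negbT; rewrite negb_forall => /existsP [l]; rewrite negb_imply.
  move=> /andP [lj ml]; case: ifP => // iS.
  have /forall_inP/(_ _ iS) ji := jmin.
  have /ilt/andP [_] : (l < i)%N by apply: leq_trans ji.
  by rewrite (negPf ml).
rewrite mcoeff0; case: ifP => // iS; have := none i; rewrite iS /=.
move=> /negbT; rewrite negb_forall => /existsP [j]; rewrite negb_imply -ltnNge.
by move=> /andP [jS /ilt]; rewrite jS.
Qed.

Lemma mcoeff_koszul_term a (i : 'I_q) (p : R) m :
  ((-1) ^+ a * yvar K k i * p)@_m =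
    if (0 < m (lift k i))%N then (-1) ^+ a * p@_(m - U_(lift k i)) else 0.
Proof.
by rewrite -mulrA mcoeff_signM mcoeffXiM; case: ifP => // _; rewrite mulr0.
Qed.

Lemma koszul_sign_min (i : 'I_q) S :
  (forall j : 'I_q, (j < i)%N -> j \notin S) -> koszul_sign i S = 0%N.
Proof.
move=> h; apply/eqP; rewrite cards_eq0; apply/eqP/setP => j; rewrite !inE.
by case ji: (j < i)%N; rewrite ?andbF // (negPf (h j ji)).
Qed.

(** Checked one monomial at a time, using the first variable [i0] of (m, S). For empty S a monomial
    free of the variables y has no such variable; this is the homology of degree 0. *)
Lemma homotopyP z S :
  (forall S', \sum_(i | i \notin S') (-1) ^+ koszul_sign i S' * yvar K k i * z (i |: S') = 0) ->
  S != set0 ->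
  \sum_(i | i \notin S) (-1) ^+ koszul_sign i S * yvar K k i * homotopy z (i |: S) = z S.
Proof.
move=> dz Sn0; apply/mpolyP => m; have [i0 least] := least_var_exists m Sn0.
have [i0P i0lt] := least; rewrite linear_sum /=.
(* Moving a variable from the monomial to S does not change the first variable. *)
have least' i : i \notin S -> (0 < m (lift k i))%N ->
    least_var i0 (m - U_(lift k i)) (i |: S).
  move=> iS mi; split=> [|j ji0].
    rewrite !inE mnmBE mnm1E (inj_eq (@lift_inj _ k)).
    by have [_|ne] := eqVneq i i0; rewrite //= subn0.
  have /andP [jS mj] := i0lt j ji0; rewrite !inE (negPf jS) orbF.
  rewrite mnmBE (eqP mj) sub0n eqxx andbT.
  by apply: contraTneq mi => <-; rewrite (eqP mj).
have term i : i \notin S ->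
    ((-1) ^+ koszul_sign i S * yvar K k i * homotopy z (i |: S))@_m =
    if (0 < m (lift k i))%N && (i0 \in i |: S)
    then (-1) ^+ koszul_sign i S *
           (z ((i |: S) :\ i0))@_(m - U_(lift k i) + U_(lift k i0)) else 0.
  move=> iS; rewrite mcoeff_koszul_term; case: ifP => //= mi.
  by rewrite (mcoeff_homotopy _ (least' i iS mi)); case: ifP; rewrite ?mulr0.
rewrite (eq_bigr _ term) {term}.
(* If [i0] is not in S, only the term [i = i0] survives, and it returns the coefficient itself.
   Otherwise the cycle relation at [S :\ i0], read in the monomial [m + U_(lift k i0)], expresses
   the coefficient by the other terms. *)
have [i0S|i0S] := boolP (i0 \in S); last first.
  have mi0 : (0 < m (lift k i0))%N by move: i0P; rewrite (negPf i0S).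
  rewrite (bigD1 i0) //= big1 ?addr0 => [|i /andP [iS ne]].
    rewrite mi0 setU11 setU1K // koszul_sign_min ?mul1r => [|j /i0lt /andP [] //].
    congr (_@__); apply/mnmP => j.
    by rewrite mnmDE mnmBE mnm1E; case: eqP => [<-|_] /=; lia.
  by rewrite !inE eq_sym (negPf ne) (negPf i0S) andbF.
have /mpolyP/(_ (m + U_(lift k i0))%MM) := dz (S :\ i0).
rewrite mcoeff0 linear_sum /= (bigD1 i0) ?setD11 //= setD1K //.
rewrite mcoeff_koszul_term mnmDE mnm1E eqxx addn1 /=.
rewrite koszul_sign_min => [|j /i0lt /andP [jS _]]; last by rewrite !inE (negPf jS) andbF.
rewrite mul1r addmK => /eqP; rewrite addr_eq0 => /eqP ->.
rewrite -sumrN; apply: eq_big => [i|i iS].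
  by rewrite !inE; have [->|] := eqVneq i i0; rewrite ?i0S //= andbT.
have ne : i != i0 by apply: contraNneq iS => ->.
rewrite mcoeff_koszul_term mnmDE mnm1E (inj_eq (@lift_inj _ k)) [i0 == i]eq_sym.
rewrite (negPf ne) addn0 !inE i0S orbT andbT; case: ifP => mi; last by rewrite oppr0.
have i0i : (i0 < i)%N.
  rewrite ltn_neqAle eq_sym (inj_eq val_inj) ne /= leqNgt.
  by apply/negP => /i0lt /andP [_ /eqP mi0]; rewrite mi0 in mi.
have -> : koszul_sign i S = (koszul_sign i (S :\ i0)).+1.
  by rewrite -{1}(setD1K i0S) koszul_signU ?setD11 // i0i.
rewrite exprS mulN1r mulNr; congr (- (_ * (z _)@__)); last first.
  apply/setP => j; rewrite !inE.
  by have [->|] := eqVneq j i0; rewrite // eq_sym (negPf ne).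
apply/mnmP => j; rewrite !(mnmDE, mnmBE, mnm1E).
have [<-|_] := eqVneq (lift k i) j; last by lia.
by rewrite (inj_eq (@lift_inj _ k)) eq_sym (negPf ne) !addn0.
Qed.

End Exactness.

Section GradedFree.
Variables (K : fieldType) (n : nat).
Local Notation R := {mpoly K[n]}.

Definition gfree r (a : 'I_r -> int) (e : int) (v : 'rV[R]_r) : Prop :=
  forall l, zhomog (e - a l) (v 0 l).

Lemma graded_gfree r (a : 'I_r -> int) : graded_submod (gfree a).
Proof.
split=> [e|e l v l_lin Gv i]; last first.
  rewrite mxE addrAC addrC; apply: zhomogM; last exact: Gv.
  exact/zhomog_nat.
split=> [l|b u v Gu Gv l]; rewrite !mxE; first exact: zhomog0.
by apply: zhomogD => //; rewrite mul_mpolyC; apply: zhomogZ.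
Qed.

Lemma mpoly_scale_reg r (x : R) (v : 'rV[R]_r) : x != 0 -> x *: v = 0 -> v = 0.
Proof.
move=> x0 /rowP xv; apply/rowP => l; have := xv l; rewrite !mxE => /eqP.
by rewrite mulf_eq0 (negPf x0) => /eqP.
Qed.

Lemma mcoeff0_lin (l : R) : l \is 1.-homog for mdeg -> l@_0%MM = 0.
Proof. by move=> hl; apply: (dhomog_nemf_coeff hl); rewrite /= mdeg0. Qed.

End GradedFree.

(** * Koszul homology of graded free modules modulo x *)

Section FreeExactness.
Variables (K : fieldType) (q : nat) (k : 'I_q.+1) (c : 'I_q.+1 -> K).
Hypothesis ck : c k != 0.
Local Notation R := {mpoly K[q.+1]}.
Local Notation x := (linform c).
Local Notation y := (yvar K k).

Lemma homotopy_homog e (z : {set 'I_q} -> R) S :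
  (forall S', zhomog e (z S')) -> zhomog (e - 1) (homotopy k z S).
Proof.
move=> hz; rewrite /homotopy; case: pickP => [i _|_]; last exact: zhomog0.
have /zhomogP hzi := hz (S :\ i).
apply/zhomogP => m; rewrite mcoeff_divide_var; case: ifP => [_|]; last by rewrite eqxx.
move=> /hzi; rewrite mdegD mdeg1 => <-.
by rewrite PoszD addrK.
Qed.

Lemma homotopy_support p (z : {set 'I_q} -> R) (S : {set 'I_q}) :
  (forall S' : {set 'I_q}, #|S'| != p -> z S' = 0) ->
  #|S| != p.+1 -> homotopy k z S = 0.
Proof.
move=> z0 Sp; rewrite /homotopy; case: pickP => [i /andP [iS _]|//].
rewrite z0; last by move: Sp; rewrite (cardsD1 i S) iS add1n eqSS.
by apply/mpolyP => m; rewrite mcoeff_divide_var !mcoeff0 if_same.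
Qed.

Lemma koszul_entry r (z : {ffun {set 'I_q} -> 'rV[R]_r}) S l :
  koszul y z S 0 l =
  \sum_(i | i \notin S) (-1) ^+ koszul_sign i S * y i * z (i |: S) 0 l.
Proof.
by rewrite ffunE summxE; apply: eq_bigr => i _; rewrite mxE.
Qed.

(** Applying [elim_var] to the entries turns a cycle modulo x into a true cycle, which the homotopy
    bounds; the entries change only by multiples of x. *)
Lemma gfree_exact r (a : 'I_r -> int) p e z :
  kcycle y x (gfree a) p.+1 e z -> kboundary y x (gfree a) (gfree a) p.+1 e z.
Proof.
move=> [zC [t tC zt]].
pose f l (S : {set 'I_q}) := elim_var k c (z S 0 l).
have f0 l (S : {set 'I_q}) : #|S| != p.+1 -> f l S = 0.
  by have [_ z0] := zC S => /z0; rewrite /f => ->; rewrite mxE rmorph0.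
have fh l (S : {set 'I_q}) : zhomog (e - a l) (f l S).
  by apply: elim_var_homog; have [] := zC S.
have df l (S : {set 'I_q}) : \sum_(i | i \notin S) (-1) ^+ koszul_sign i S * y i * f l (i |: S) = 0.
  transitivity (elim_var k c (koszul y z S 0 l)).
    rewrite koszul_entry rmorph_sum; apply: eq_bigr => i _ /=.
    by rewrite !rmorphM rmorph_sign /= elim_yvar.
  by rewrite zt ffunE mxE rmorphM /= elim_linform // mul0r.
pose w := [ffun S : {set 'I_q} => \row_l homotopy k (f l) S] : {ffun {set 'I_q} -> 'rV[R]_r}.
have wC : chain (gfree a) p.+2 (e - 1) w.
  move=> S; rewrite ffunE; split=> [l|Sp].
    by rewrite mxE addrAC; apply: homotopy_homog.
  by apply/rowP => l; rewrite !mxE; apply: (homotopy_support (f0 l)).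
have [S _|u uP] := @chain_choice K q.+1 q 'rV[R]_r (fun S v => gfree a (e - 1) v /\
    z S - \row_l f l S = x *: v) p.+1.
  have /fin_all_exists [g gP] l :
      exists g, zhomog (e - a l - 1) g /\ z S 0 l - f l S = x * g.
    have [|g gh gE] := @sub_elim_var_homog K q k c ck (e - a l) (z S 0 l).
      by have [] := zC S.
    by exists g.
  exists (\row_l g l); split=> [l|]; first by rewrite mxE addrAC; case: (gP l).
  by apply/rowP => l; rewrite !mxE; case: (gP l).
have uC : chain (gfree a) p.+1 (e - 1) u.
  move=> S; have [uS u0] := uP S; split=> //.
  have [/uS [] //|/u0 ->] := eqVneq #|S| p.+1.
  by have [/(_ (e - 1)) [] ] := graded_gfree K q.+1 a.
exists w, u; split=> //; apply/ffunP => S.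
have [Sp|Sp] := eqVneq #|S| p.+1; last first.
  have [_ ->] := zC S => //; rewrite ffunE [(x *: u) S]ffunE.
  have [_ ->] := uC S => //.
  have [_ kw0] := koszul_chain (yvar_homog K k) (graded_gfree K q.+1 a) wC S.
  by rewrite kw0 // scaler0 addr0.
have [/(_ Sp) [_ uE] _] := uP S.
rewrite ffunE [(x *: u) S]ffunE -uE addrC -[LHS](subrK (\row_l f l S)).
congr (_ + _); apply/rowP => l; rewrite mxE koszul_entry.
rewrite (eq_bigr (fun i => (-1) ^+ koszul_sign i S * y i * homotopy k (f l) (i |: S))).
  by rewrite homotopyP // -cards_eq0 Sp.
by move=> i _; rewrite ffunE mxE.
Qed.

(** x and y generate m, so the homology of degree 0 is the free module modulo m. *)
Lemma kboundary0P r (a : 'I_r -> int) e z :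
  chain (gfree a) 0 e z ->
  kboundary y x (gfree a) (gfree a) 0 e z <-> forall l, (z set0 0 l)@_0%MM = 0.
Proof.
move=> zC; split=> [[w [t [wC tC ->]]] l|z0].
  rewrite ffunE mxE mcoeffD koszul_entry linear_sum /= big1 => [|i _].
    by rewrite ffunE mxE rmorphM /= mcoeff0_lin ?linform_homog // mul0r addr0.
  by rewrite !rmorphM /= (mcoeff0_lin (yvar_homog K k i)) mulr0 mul0r.
have /fin_all_exists [g gP] l : exists g : ('I_q -> R) * R,
    [/\ forall i, zhomog (e - a l - 1) (g.1 i), zhomog (e - a l - 1) g.2 &
        z set0 0 l = \sum_i y i * g.1 i + x * g.2].
  have [|r' [t [hr ht zE]]] := ideal_decomposition ck (z0 l) (e := e - a l).
    by have [] := zC set0.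
  by exists (r', t).
(* The sum selects the coefficient of [y i] when S is the singleton of [i] and is empty for all
   other S. *)
pose w := [ffun S : {set 'I_q} => \row_l \sum_(i | S == [set i]) (g l).1 i]
  : {ffun {set 'I_q} -> 'rV[R]_r}.
pose t := [ffun S : {set 'I_q} => if S == set0 then \row_l (g l).2 else 0]
  : {ffun {set 'I_q} -> 'rV[R]_r}.
exists w, t; split.
- move=> S; rewrite ffunE; split=> [l|Sp].
    rewrite mxE; apply: big_ind => [|*|i _]; [exact: zhomog0|exact: zhomogD|].
    by rewrite addrAC; case: (gP l).
  apply/rowP => l; rewrite !mxE big1 // => i /eqP Si.
  by rewrite Si cards1 in Sp.
- move=> S; rewrite ffunE; case: eqP => [->|_]; last first.
    by split=> // l; rewrite mxE; apply: zhomog0.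
  by split=> [l|]; [rewrite mxE addrAC; case: (gP l)|rewrite cards0].
apply/ffunP => S; have [->|Sn0] := eqVneq S set0; last first.
  have [_ ->] := zC S; last by rewrite cards_eq0.
  rewrite !ffunE (negPf Sn0) scaler0 addr0; apply/esym.
  apply: big1 => i iS; rewrite ffunE [X in _ *: X](_ : _ = 0) ?scaler0 //.
  apply/rowP => l; rewrite !mxE big1 // => j /eqP Sj.
  have : S \subset [set j] by rewrite -Sj subsetUr.
  rewrite subset1 (negPf Sn0) orbF => /eqP SE.
  by move: iS; rewrite SE inE; have := setU11 i S; rewrite Sj inE => ->.
apply/rowP => l; have [_ _ ->] := gP l.
rewrite [in RHS]ffunE mxE koszul_entry !ffunE eqxx !mxE; congr (_ + _).
apply: eq_big => [i|i _]; first by rewrite inE.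
rewrite koszul_sign_min ?mul1r => [|j _]; last by rewrite inE.
rewrite ffunE mxE setU0 (bigD1 i) //= big1 ?addr0 // => j /andP [/eqP /set1_inj ->].
by rewrite eqxx.
Qed.

End FreeExactness.

(** * Betti numbers as Koszul homology *)

Section Functoriality.
Variables (K : fieldType) (n q : nat) (y : 'I_q -> {mpoly K[n]}) (x : {mpoly K[n]}).
Implicit Types (V W : lmodType {mpoly K[n]}).

Lemma kcycle_sub V (M N : int -> V -> Prop) p e z :
  (forall e v, M e v -> N e v) -> kcycle y x M p e z -> kcycle y x N p e z.
Proof.
move=> MN [zC [t tC zt]]; split; first by apply: chain_sub zC => v; apply: MN.
by exists t => //; apply: chain_sub tC => v; apply: MN.
Qed.

Lemma kboundary_sub V (M N P Q : int -> V -> Prop) p e z :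
  (forall e v, M e v -> N e v) -> (forall e v, P e v -> Q e v) ->
  kboundary y x M P p e z -> kboundary y x N Q p e z.
Proof.
move=> MN PQ [w [t [wC tC ->]]]; exists w, t; split=> //.
  by apply: chain_sub wC => v; apply: MN.
by apply: chain_sub tC => v; apply: PQ.
Qed.

Lemma kboundary_cmap V W (M : int -> V -> Prop) (N : int -> W -> Prop)
    (phi : {linear V -> W}) p e z :
  (forall e v, M e v -> N e (phi v)) ->
  kboundary y x M M p e z -> kboundary y x N N p e (cmap phi z).
Proof.
move=> MN [w [t [wC tC ->]]]; exists (cmap phi w), (cmap phi t).
split; [by apply: chain_cmap wC => v; apply: MN|by apply: chain_cmap tC => v; apply: MN|].
by rewrite linearD linearZ koszul_cmap.
Qed.

Lemma quot_dim_ext V (Z B Z' B' : V -> Prop) k :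
  (forall z, Z z <-> Z' z) -> (forall z, B z <-> B' z) ->
  quot_dim Z B k -> quot_dim Z' B' k.
Proof.
move=> ZZ BB [v [Zv sv fv]]; exists v; split=> [i|z /ZZ /sv [c /BB]|c /BB /fv //].
  exact/ZZ.
by exists c.
Qed.

Definition single V (v : V) : {ffun {set 'I_q} -> V} :=
  [ffun S => if S == set0 then v else 0].

Lemma single_is_linear V : linear (@single V).
Proof.
by move=> a u v; apply/ffunP => S; rewrite !ffunE; case: eqP; rewrite // scaler0 addr0.
Qed.

HB.instance Definition _ V :=
  GRing.isLinear.Build {mpoly K[n]} V {ffun {set 'I_q} -> V} _ (@single V)
    (@single_is_linear V).

Lemma cmap_single V W (phi : {linear V -> W}) v :
  cmap phi (single v) = single (phi v).
Proof.
by apply/ffunP => S; rewrite !ffunE; case: eqP => // _; rewrite linear0.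
Qed.

Lemma chain_single V (M : int -> V -> Prop) e v :
  subspace (M e) -> M e v -> chain M 0 e (single v).
Proof.
move=> [M0 _] Mv S; rewrite ffunE; case: eqP => [->|Sn0]; split=> //.
by rewrite cards0.
Qed.

Lemma chain0_single V (M : int -> V -> Prop) e z :
  chain M 0 e z -> z = single (z set0).
Proof.
move=> zC; apply/ffunP => S; rewrite ffunE; case: eqP => [->//|/eqP Sn0].
by have [_ ->] := zC S; rewrite // cards_eq0.
Qed.

Definition cst_row r (u : 'rV[K]_r) : 'rV[{mpoly K[n]}]_r :=
  map_mx (@mpolyC n K) u.

Lemma cst_row_lin r a (u v : 'rV[K]_r) :
  cst_row (a *: u + v) = a%:MP *: cst_row u + cst_row v.
Proof. by rewrite /cst_row map_mxD map_mxZ. Qed.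

Lemma quot_dim_mx r m1 m2 (A : 'M[K]_(m1, r)) (B : 'M[K]_(m2, r)) :
  (B <= A)%MS ->
  quot_dim (fun v => exists2 u, (u <= A)%MS & v = cst_row u)
    (fun v => exists2 u, (u <= B)%MS & v = cst_row u) (\rank A - \rank B).
Proof.
move=> BA; have [W [WA sW fW]] := mx_quot_basis BA.
have lc a : lcomb (fun i => cst_row (row i W)) a = cst_row (a *m W).
  rewrite mulmx_sum_row /lcomb; elim/big_rec2: _ => [|i u v _ ->].
    by rewrite /cst_row map_mx0.
  by rewrite cst_row_lin.
exists (fun i => cst_row (row i W)); split.
- by move=> i; exists (row i W) => //; apply: submx_trans (row_sub _ _) WA.
- move=> _ [u /sW [a ua] ->]; exists a; rewrite lc; exists (u - a *m W) => //.
  by rewrite /cst_row map_mxB.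
- move=> a [u uB]; rewrite lc => /rowP E; apply: fW.
  suff -> : a *m W = u by [].
  by apply/rowP => l; have := E l; rewrite !mxE => /eqP; rewrite mpolyC_eq => /eqP.
Qed.

End Functoriality.

(** * Dimension shifting along the resolution *)

Section Balancing.
Variables (K : fieldType) (q : nat) (k : 'I_q.+1) (c : 'I_q.+1 -> K).
Hypothesis ck : c k != 0.
Local Notation R := {mpoly K[q.+1]}.
Local Notation x := (linform c).
Local Notation y := (yvar K k).
Variables (I : R -> Prop) (F : graded_free_resolution I).

(** The resolution extended by R, with indices raised by one: then [syz] of index 0 is I and [syz]
    of index i is the i-th syzygy, so that one induction treats them alike. *)
Definition aug_rank (i : nat) : nat := if i is i'.+1 then res_rank F i' else 1.

Definition aug_shift (i : nat) : 'I_(aug_rank i) -> int :=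
  match i return 'I_(aug_rank i) -> int with
  | 0 => fun=> 0
  | i'.+1 => @res_shift _ _ _ F i'
  end.

Definition aug_diff (i : nat) : 'M[R]_(aug_rank i.+1, aug_rank i) :=
  match i return 'M[R]_(aug_rank i.+1, aug_rank i) with
  | 0 => res_aug F
  | i'.+1 => res_diff F i'
  end.

Lemma aug_diff_homog i a b :
  zhomog (aug_shift a - aug_shift b) (aug_diff i a b).
Proof.
case: i a b => [|i] a b; rewrite -shifted_homogE; last exact: res_diff_homog.
by rewrite [b]ord1; apply: res_aug_homog.
Qed.

Lemma aug_diff_exact i (v : 'rV_(aug_rank i.+1)) :
  v *m aug_diff i = 0 <-> exists w, v = w *m aug_diff i.+1.
Proof. by case: i v => [|i] v; [apply: res_aug_exact|apply: res_diff_exact]. Qed.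

Local Notation G i := (gfree (@aug_shift i)).

Definition syz (i : nat) (e : int) (v : 'rV[R]_(aug_rank i)) : Prop :=
  exists2 w, G i.+1 e w & w *m aug_diff i = v.

Definition row_comp r (a : 'I_r -> int) e (w : 'rV[R]_r) : 'rV[R]_r :=
  \row_l zcomp (e - a l) (w 0 l).

Lemma gfree_row_comp r (a : 'I_r -> int) e (w : 'rV[R]_r) :
  gfree a e (row_comp a e w).
Proof. by move=> l; rewrite mxE; apply: zcomp_zhomog. Qed.

Lemma row_comp_id r (a : 'I_r -> int) e (w : 'rV[R]_r) :
  gfree a e w -> row_comp a e w = w.
Proof.
by move=> Gw; apply/rowP => l; rewrite mxE (zcompE _ (Gw l)) eqxx.
Qed.

Lemma row_comp_aug_diff i e w :
  row_comp (@aug_shift i.+1) e w *m aug_diff i =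
  row_comp (@aug_shift i) e (w *m aug_diff i).
Proof.
apply/rowP => l; rewrite !mxE linear_sum; apply: eq_bigr => a _ /=.
rewrite mxE -(zcompM _ _ (aug_diff_homog a l)).
by rewrite addrA subrK.
Qed.

Lemma aug_diff_gfree i e w : G i.+1 e w -> G i e (w *m aug_diff i).
Proof.
by move=> /row_comp_id <-; rewrite row_comp_aug_diff; apply: gfree_row_comp.
Qed.

Lemma syz_gfree i e v : syz e v -> G i e v.
Proof. by move=> [w Gw <-]; apply: aug_diff_gfree. Qed.

(** The exactness given with the resolution concerns arbitrary vectors; the component of degree e of
    a preimage makes it graded. *)
Lemma syz_exact i e (v : 'rV_(aug_rank i.+1)) :
  syz e v <-> G i.+1 e v /\ v *m aug_diff i = 0.
Proof.
split=> [vS|[Gv /aug_diff_exact [w vw]]].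
  split; first exact: syz_gfree.
  by have [w _ vw] := vS; apply/aug_diff_exact; exists w.
exists (row_comp (@aug_shift i.+2) e w); first exact: gfree_row_comp.
by rewrite row_comp_aug_diff -vw row_comp_id.
Qed.

Lemma syz0P e v : syz (i := 0) e v <-> zhomog e (v 0 0) /\ I (v 0 0).
Proof.
split=> [vS|[hv /(res_aug_image F) [w vw]]].
  split; first by have := syz_gfree vS 0; rewrite subr0.
  by have [w _ vw] := vS; apply/(res_aug_image F); exists w; rewrite -vw.
have vE : v = w *m aug_diff 0 by apply/matrixP => i j; rewrite [i]ord1 [j]ord1.
exists (row_comp (@aug_shift 1) e w); first exact: gfree_row_comp.
rewrite row_comp_aug_diff -vE row_comp_id // => l.
by rewrite [l]ord1 subr0.
Qed.

Lemma graded_syz i : graded_submod (@syz i).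
Proof.
have [sG gG] := graded_gfree K q.+1 (@aug_shift i.+1); split=> [e|e l _ hl [w Gw <-]].
  have [G0 GL] := sG e.
  split=> [|b _ _ [u Gu <-] [v Gv <-]]; first by exists 0; rewrite ?mul0mx.
  by exists (b%:MP *: u + v); [apply: GL|rewrite mulmxDl scalemxAl].
by exists (l *: w); [apply: gG|rewrite scalemxAl].
Qed.

Definition cst_part r (v : 'rV[R]_r) : 'rV[K]_r := map_mx (mcoeff 0%MM) v.

Lemma cst_rowK r (u : 'rV[K]_r) : cst_part (cst_row q.+1 u) = u.
Proof. by apply/rowP => l; rewrite !mxE mpolyCK. Qed.

Lemma tor_chainsP i e (u : 'rV[K]_(res_rank F i)) :
  (u <= tor_chains F i e)%MS <-> forall l, u 0 l != 0 -> @aug_shift i.+1 l = e.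
Proof.
split=> [/submxP [w ->] l|h].
  rewrite mul_mx_diag !mxE; case: (eqVneq _ e) => // _.
  by rewrite mulr0 eqxx.
apply/submxP; exists u; apply/rowP => l; rewrite mul_mx_diag !mxE.
have [->|/h sl] := eqVneq (u 0 l) 0; first by rewrite mul0r.
by move: sl => /= ->; rewrite eqxx mulr1.
Qed.

Lemma gfree_cst_row i e u : (u <= tor_chains F i e)%MS -> G i.+1 e (cst_row q.+1 u).
Proof.
move=> /tor_chainsP h l; rewrite mxE.
have [->|/h ->] := eqVneq (u 0 l) 0; first by rewrite mpolyC0; apply: zhomog0.
by rewrite subrr; apply: zhomogC.
Qed.

Lemma gfree_cst_part i e w : G i.+1 e w -> (cst_part w <= tor_chains F i e)%MS.
Proof.
move=> Gw; apply/tor_chainsP => l; rewrite mxE => w0.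
have /zhomogP/(_ _ w0) := Gw l; rewrite mdeg0 => /esym/eqP.
by rewrite subr_eq0 => /eqP.
Qed.

(** In index 0 there is no condition: [aug_diff 0] is the augmentation, which does not belong to the
    complex that computes Tor. *)
Definition tor_cycle_cond (i : nat) : 'rV[R]_(aug_rank i) -> Prop :=
  match i return 'rV[R]_(aug_rank i) -> Prop with
  | 0 => fun=> True
  | _.+1 => fun v => cst_part v = 0
  end.

Lemma tor_cycle_cond_subspace i : subspace (@tor_cycle_cond i).
Proof.
case: i => [//|i]; split=> [|b u v]; rewrite /= /cst_part ?map_mx0 //.
by rewrite map_mxD map_mxZ => -> ->; rewrite scaler0 addr0.
Qed.

Lemma tor_cycle_cond_cst i w : cst_part w = 0 -> tor_cycle_cond (w *m aug_diff i).
Proof.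
by case: i w => [//|i] w; rewrite /= /cst_part map_mxM => ->; rewrite mul0mx.
Qed.

Lemma tor_cyclesP i e (u : 'rV_(res_rank F i)) :
  (u <= tor_cycles F i e)%MS <->
  (u <= tor_chains F i e)%MS /\ tor_cycle_cond (cst_row q.+1 u *m aug_diff i).
Proof.
case: i u => [|i] u; first by split=> [|[]].
rewrite /= sub_capmx /cst_part map_mxM -/(cst_part _) cst_rowK.
by split=> [/andP [-> /sub_kermxP]|[-> h]] //; apply/andP; split=> //; apply/sub_kermxP.
Qed.

Lemma kboundary_cst_part0 i e w : G i.+1 e w -> cst_part w = 0 ->
  kboundary y x (@syz i) (@syz i) 0 e (single q (w *m aug_diff i)).
Proof.
move=> Gw /rowP w0; rewrite -[w *m _]/(mulmxr _ w) -cmap_single.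
apply: kboundary_cmap; last apply/kboundary0P => //.
- by move=> d v Gv; exists v.
- apply: chain_single => //; have [sG _] := graded_gfree K q.+1 (@aug_shift i.+1).
  exact: sG.
- by move=> l; rewrite ffunE eqxx; have := w0 l; rewrite !mxE.
Qed.

(** For i > 0, Tor_i is the kernel of the map from the i-th syzygy modulo m to F_(i-1) modulo m; for
    i = 0 it is I/mI. A Tor cycle [u], read as a constant row, corresponds to its image in the
    syzygy. *)
Lemma tor_koszul i e :
  quot_dim (fun z => chain (@syz i) 0 e z /\ tor_cycle_cond (z set0))
    (kboundary y x (@syz i) (@syz i) 0 e)
    (\rank (tor_cycles F i e) - \rank (tor_boundaries F i e)).
Proof.
have [sS gS] := graded_syz i.
have [sG gG] := graded_gfree K q.+1 (@aug_shift i.+1).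
have sKB : subspace (kboundary y x (@syz i) (@syz i) 0 e).
  exact: subspace_kboundary.
have sC := tor_cycle_cond_subspace i.
pose D : {linear 'rV[R]_(aug_rank i.+1) -> 'rV[R]_(aug_rank i)} := mulmxr (aug_diff i).
apply: (quot_dim_iso (rho := fun v z => (exists2 u, (u <= tor_cycles F i e)%MS &
    v = cst_row q.+1 u) /\
    kboundary y x (@syz i) (@syz i) 0 e (z - single q (v *m aug_diff i))) _ _ _ _ _
    (quot_dim_mx q.+1 (tor_boundaries_sub_cycles F i e))).
- split; first by exists 0; rewrite ?sub0mx // /cst_row map_mx0.
  by rewrite mul0mx linear0 subr0; apply: (subspace0 sKB).
- move=> b _ z1 _ z2 [[u1 h1 ->] kz1] [[u2 h2 ->] kz2]; split.
    exists (b *: u1 + u2); first by rewrite addmx_sub // scalemx_sub.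
    by rewrite cst_row_lin.
  have [_ /(_ b _ _ kz1 kz2)] := sKB; congr kboundary.
  by rewrite mulmxDl -scalemxAl linearP /= opprD addrACA scalerBr.
- move=> _ [u /[dup] uA /tor_cyclesP [uC uD] ->].
  exists (single q (cst_row q.+1 u *m aug_diff i)).
    split; last by rewrite ffunE eqxx.
    apply: chain_single => //; exists (cst_row q.+1 u) => //.
    exact: gfree_cst_row.
  split; first by exists u.
  by rewrite subrr; apply: (subspace0 sKB).
- move=> z [zC zD]; have [[w Gw wz] _] := zC set0.
  (* A row without constant part maps into m times the syzygy, so only the constant part of [w]
     counts. *)
  pose w' := w - cst_row q.+1 (cst_part w).
  have w'0 : cst_part w' = 0 by rewrite /cst_part map_mxB -!/(cst_part _) cst_rowK subrr.
  have Gc : G i.+1 e (cst_row q.+1 (cst_part w)).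
    exact/gfree_cst_row/gfree_cst_part.
  have Gw' : G i.+1 e w' by apply: (subspaceB (sG e)).
  have uA : (cst_part w <= tor_cycles F i e)%MS.
    apply/tor_cyclesP; split; first exact: gfree_cst_part.
    have -> : cst_row q.+1 (cst_part w) = w - w' by rewrite subKr.
    rewrite mulmxBl wz; apply: (subspaceB sC) => //; exact: tor_cycle_cond_cst.
  exists (cst_row q.+1 (cst_part w)); first by exists (cst_part w).
  split; first by exists (cst_part w).
  rewrite (chain0_single zC) -linearB /= -wz -mulmxBl.
  exact: kboundary_cst_part0.
- move=> v z [[u uA ->] kz].
  have uC : (u <= tor_chains F i e)%MS by have /tor_cyclesP [] := uA.
  have Gu := gfree_cst_row uC.
  have -> : kboundary y x (@syz i) (@syz i) 0 e z <->
      kboundary y x (@syz i) (@syz i) 0 e (single q (cst_row q.+1 u *m aug_diff i)).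
    split=> [h|h]; last by rewrite -[z](subrK (single q (cst_row q.+1 u *m aug_diff i)));
      apply: (subspaceD sKB).
    by rewrite -[single _ _](subKr z); apply: (subspaceB sKB).
  split.
    (* A boundary [u] is the constant part of some [f] that the differential kills;
       [cst_row q.+1 u - f] has the same image as [cst_row q.+1 u] and no constant part. *)
    move=> [_ /submxP [s ->] /(congr1 (@cst_part _))]; rewrite !cst_rowK => uE.
    pose s' := s *m tor_chains F i.+1 e.
    have s'C : (s' <= tor_chains F i.+1 e)%MS by apply: submxMl.
    pose f := cst_row q.+1 s' *m aug_diff i.+1.
    have Gf : G i.+1 e f by apply: aug_diff_gfree; apply: gfree_cst_row.
    have fu : cst_part f = u.
      by rewrite /f /cst_part map_mxM -/(cst_part _) cst_rowK uE mulmxA.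
    have f0 : f *m aug_diff i = 0 by apply/aug_diff_exact; exists (cst_row q.+1 s').
    have -> : cst_row q.+1 u *m aug_diff i = (cst_row q.+1 u - f) *m aug_diff i.
      by rewrite mulmxBl f0 subr0.
    apply: kboundary_cst_part0; first exact: (subspaceB (sG e)).
    by rewrite /cst_part map_mxB -!/(cst_part _) cst_rowK fu subrr.
  move=> [w [t [wC tC E]]].
  have lift p d g : chain (@syz i) p d g -> exists2 h, chain (G i.+1) p d h & cmap D h = g.
    by apply: chain_lift => // v' [w' Gw' <-]; exists w'.
  have [w' w'C w'E] := lift _ _ _ _ wC; have [t' t'C t'E] := lift _ _ _ _ tC.
  pose b := koszul y w' + x *: t'.
  have bK : kboundary y x (G i.+1) (G i.+1) 0 e b by exists w', t'.
  have bC : chain (G i.+1) 0 e b.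
    apply: kboundary_chain bK => //; [exact: linform_homog|exact: yvar_homog].
  have b0 := (kboundary0P ck bC).1 bK.
  (* Conversely, [g] is killed by the differential, hence comes from the next term of the
     resolution; its constant part is [u] because [b] lies in m. *)
  pose g := cst_row q.+1 u - b set0.
  have Gg : G i.+1 e g by apply: (subspaceB (sG e)) => //; have [] := bC set0.
  have g0 : g *m aug_diff i = 0.
    rewrite mulmxBl; apply/eqP; rewrite subr_eq0; apply/eqP.
    transitivity (single q (cst_row q.+1 u *m aug_diff i) set0).
      by rewrite ffunE eqxx.
    rewrite E -w'E -t'E koszul_cmap -linearZ -linearD /= -/b.
    by rewrite ffunE.
  have [h Gh hg] := (syz_exact e g).2 (conj Gg g0).
  exists u => //.
  have -> : u = cst_part h *m tor_diff F i.
    have -> : cst_part h *m tor_diff F i = cst_part g by rewrite -hg /cst_part map_mxM.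
    rewrite /cst_part map_mxB -!/(cst_part _) cst_rowK.
    by rewrite [X in _ - X](_ : _ = 0) ?subr0 //; apply/rowP => l; rewrite !mxE b0.
  rewrite /tor_boundaries submxMr //; exact: gfree_cst_part.
Qed.

Lemma betti_koszul0 (e : int) :
  quot_dim (kcycle y x (@syz 0) 0 e) (kboundary y x (@syz 0) (@syz 0) 0 e)
    (betti F 0%:Z e).
Proof.
apply: quot_dim_ext (tor_koszul 0 e) => // z; split=> [[zC _]|[]] //.
split=> //; exists 0; last by rewrite (koszul_chain0 _ zC) scaler0.
by apply: chain0; have [] := graded_syz 0.
Qed.

(** Each connecting isomorphism lowers the Koszul degree and raises the index of the syzygy. The
    requirement in [koszul_shift] of being a boundary in G holds automatically in positive degree;
    in degree 0 it says that the constant part vanishes, which is the condition on Tor cycles. *)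
Lemma betti_koszulS p i (e : int) :
  quot_dim (kcycle y x (@syz i) p.+1 e) (kboundary y x (@syz i) (@syz i) p.+1 e)
    (betti F (i + p.+1)%N (e + p.+1%:Z)).
Proof.
have gG := graded_gfree K q.+1; have gS := graded_syz.
have xreg r (v : 'rV[R]_r) : x *: v = 0 -> v = 0.
  by apply: mpoly_scale_reg; apply: linform_neq0 ck.
have shift j d m b :
    quot_dim (fun z => kcycle y x (@syz j.+1) m (d + 1) z /\
                       kboundary y x (G j.+1) (G j.+1) m (d + 1) z)
      (kboundary y x (@syz j.+1) (@syz j.+1) m (d + 1)) b ->
    quot_dim (kcycle y x (@syz j) m.+1 d) (kboundary y x (@syz j) (@syz j) m.+1 d) b.
  move=> h.
  apply: (@koszul_shift _ _ _ _ x (linform_homog c) (yvar_homog K k) _ _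
    (G j.+1) (@syz j) (mulmxr (aug_diff j))) => //.
  - exact: xreg.
  - by move=> z; apply: gfree_exact.
  - have sub1 e' v : syz e' v -> G j.+1 e' v /\ mulmxr (aug_diff j) v = 0.
      by move/syz_exact.
    have sub2 e' v : G j.+1 e' v /\ mulmxr (aug_diff j) v = 0 -> syz e' v.
      by move/syz_exact.
    apply: quot_dim_ext h => z; split.
    + by move=> [zC zB]; split=> //; apply: kcycle_sub zC.
    + by move=> [zC zB]; split=> //; apply: kcycle_sub zC.
    + by apply: kboundary_sub.
    + by apply: kboundary_sub.
elim: p i e => [|p IH] i e; apply: shift.
  rewrite addn1; apply: quot_dim_ext (tor_koszul i.+1 (e + 1)) => // z; split.
    move=> [zC z0]; split.
      split=> //; exists 0; last by rewrite (koszul_chain0 _ zC) scaler0.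
      by apply: chain0; have [] := gS i.+1.
    apply/kboundary0P => //; first by apply: chain_sub zC => v; apply: syz_gfree.
    by move=> l; move/rowP/(_ l): z0; rewrite !mxE.
  move=> [[zC _] zB]; split=> //; apply/rowP => l; rewrite !mxE.
  have GC : chain (G i.+1) 0 (e + 1) z by apply: chain_sub zC => v; apply: syz_gfree.
  exact: (kboundary0P ck GC).1 zB l.
have := IH i.+1 (e + 1); rewrite addSnnS -addrA -[1 + _]/(Posz (1 + p.+1)) => h.
apply: quot_dim_ext h => // z; split=> [zC|[]] //; split=> //.
apply: (gfree_exact ck); apply: kcycle_sub zC => d v; exact: syz_gfree.
Qed.

End Balancing.

(** * Betti numbers of m-full ideals *)

Section FiniteBasis.
Variables (K : fieldType) (n : nat).
Implicit Types (V : lmodType {mpoly K[n]}).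

Lemma quot_dim_fin V (Z B : V -> Prop) (T : finType) (v : T -> V) :
  (forall t, Z (v t)) ->
  (forall z, Z z -> exists c : T -> K, B (z - \sum_t (c t)%:MP *: v t)) ->
  (forall c : T -> K, B (\sum_t (c t)%:MP *: v t) -> forall t, c t = 0) ->
  quot_dim Z B #|T|.
Proof.
move=> Zv sv fv; exists (fun i => v (enum_val i)).
have lcE (c : 'rV[K]_#|T|) : lcomb (fun i => v (enum_val i)) c =
    \sum_t (c 0 (enum_rank t))%:MP *: v t.
  rewrite (reindex (fun i : 'I_#|T| => enum_val i)) /=; last exact: (onW_bij _ (enum_val_bij T)).
  by apply: eq_bigr => i _; rewrite enum_valK.
split=> [//|z /sv [c Bc]|c].
  exists (\row_i c (enum_val i)); rewrite lcE.
  by under eq_bigr => t _ do rewrite mxE enum_rankK.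
by rewrite lcE => /fv c0; apply/rowP => i; have := c0 (enum_val i); rewrite enum_valK mxE.
Qed.

(** A p-chain has one free coefficient for each p-subset of the indices of y: this is the source of
    the binomial coefficients. *)
Lemma quot_dim_chain V q (M N : int -> V -> Prop) p e s :
  subspace (M e) -> subspace (N e) ->
  quot_dim (M e) (N e) s ->
  quot_dim (@chain K n q V M p e) (chain N p e) ('C(q, p) * s).
Proof.
move=> sM sN [v [Mv sv fv]].
pose T : finType := ({S : {set 'I_q} | #|S| == p} * 'I_s)%type.
have -> : ('C(q, p) * s)%N = #|T|.
  rewrite card_prod card_ord card_sig; congr (_ * _)%N.
  by rewrite -{1}[q]card_ord -card_draws; apply: eq_card => S; rewrite !inE.
pose w (t : T) : {ffun {set 'I_q} -> V} := [ffun S => if S == val t.1 then v t.2 else 0].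
have wE (c : T -> K) (S : {set 'I_q}) :
    (\sum_t (c t)%:MP *: w t) S = if insub S is Some S' then
      lcomb v (\row_b c (S', b)) else 0.
  rewrite sum_ffunE; transitivity (\sum_(t : T) if val t.1 == S then (c t)%:MP *: v t.2 else 0).
    by apply: eq_bigr => t _; rewrite !ffunE eq_sym; case: eqP; rewrite ?scaler0.
  rewrite -big_mkcond /=; case: insubP => [S' _ S'E|SF]; last first.
    by apply: big1 => t /eqP St; have := valP t.1; rewrite /= St (negPf SF).
  transitivity (\sum_(t : T | (t.1 == S') && true) (c (t.1, t.2))%:MP *: v t.2).
    by apply: eq_big => [t|[]] //; rewrite andbT -S'E (inj_eq val_inj).
  rewrite -(pair_big_dep (fun a => a == S') (fun _ _ => true)
    (fun a b => (c (a, b))%:MP *: v b)) /= big_pred1_eq.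
  by apply: eq_bigr => b _; rewrite mxE.
apply: (quot_dim_fin (v := w)).
- move=> [S b] S'; rewrite ffunE; case: eqP => [->|_] /=; split=> //.
  + by rewrite (valP S).
  + exact: subspace0.
- move=> z zC.
  have /fin_all_exists [f fP] (S : {S : {set 'I_q} | #|S| == p}) :
      exists c, N e (z (val S) - lcomb v c).
    by apply: sv; have [] := zC (val S).
  exists (fun t => f t.1 0 t.2) => S.
  rewrite ffunE [X in _ + X]ffunE wE.
  case: insubP => [S' SS' <-|SF].
    rewrite [X in lcomb v X](_ : _ = f S'); last by apply/rowP => b; rewrite mxE.
    by split=> //; have := valP S' => /= /eqP ->; rewrite eqxx.
  rewrite subr0; have [_ ->] := zC S => //.
  by split=> //; apply: subspace0.
- move=> c cC [S b].
  have [] := cC (val S); rewrite wE; case: insubP => [S' _ /val_inj ->|]; last first.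
    by rewrite (valP S).
  by move=> /fv /rowP /(_ b); rewrite !mxE.
Qed.

End FiniteBasis.

(** * Splitting off the multiples of x from a Koszul strand *)

Section Strand.
Variables (K : fieldType) (n q : nat) (y : 'I_q -> {mpoly K[n]}) (x : {mpoly K[n]}).
Hypothesis x_lin : x \is 1.-homog for mdeg.
Hypothesis y_lin : forall i, y i \is 1.-homog for mdeg.
Variables (V : lmodType {mpoly K[n]}) (M P : int -> V -> Prop).
Hypothesis gM : graded_submod M.
Hypothesis gP : graded_submod P.
Hypothesis MP : forall e v, M e v -> P e v.
(** The form in which m-fullness enters, with I for M and R for P. *)
Hypothesis full : forall e u (w : 'I_q -> V), P e u -> (forall i, M e (w i)) ->
  x *: u = \sum_i y i *: w i -> M e u.

(** For M = I and P = R, division by x identifies [xmultiples] modulo [xmod] with (I : x)/I one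
    degree lower, which is the socle of R/I for the chosen x. *)
Definition xmultiples (e : int) (v : V) : Prop :=
  M e v /\ exists2 u, P (e - 1) u & v = x *: u.

Definition xmod (e : int) (v : V) : Prop := exists2 u, M (e - 1) u & v = x *: u.

Lemma subspace_xmod e : subspace (xmod e).
Proof.
have [sM _] := gM; have [M0 ML] := sM (e - 1).
split=> [|a _ _ [u Mu ->] [v Mv ->]]; first by exists 0; rewrite ?scaler0.
exists (a%:MP *: u + v); first exact: ML.
by rewrite scalerDr !scalerA mulrC.
Qed.

Lemma subspace_xmultiples e : subspace (xmultiples e).
Proof.
have [sM _] := gM; have [sP _] := gP.
have [M0 ML] := sM e; have [P0 PL] := sP (e - 1).
split=> [|a u' v' [Mu [u Pu uE]] [Mv [v Pv vE]]].
  by split=> //; exists 0; rewrite ?scaler0.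
split; first exact: ML.
exists (a%:MP *: u + v); first exact: PL.
by rewrite uE vE scalerDr !scalerA [x * _]mulrC.
Qed.

(** Each entry of a Koszul differential is a combination of the [y i] with coefficients in M, so
    [full] applies to it. *)
Lemma koszul_full p e z u : chain M p e z -> chain P p.-1 e u ->
  koszul y z = x *: u -> chain M p.-1 e u.
Proof.
move=> zC uC zu S; have [Pu u0] := uC S; split=> //.
apply: (@full _ _ (fun i => if i \notin S then (-1) ^+ koszul_sign i S *: z (i |: S) else 0)) => //.
  have [sM _] := gM; move=> i; case: ifP => _; last by apply: subspace0.
  have [Mz _] := zC (i |: S).
  rewrite -signr_odd; case: odd; rewrite ?expr0 ?scale1r // expr1 scaleN1r.
  exact: subspaceN.
have := congr1 (fun f : {ffun {set 'I_q} -> V} => f S) zu; rewrite !ffunE => <-.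
rewrite big_mkcond; apply: eq_bigr => i _; case: ifP => _; last by rewrite scaler0.
by rewrite scalerA mulrC.
Qed.

(** If z = dw + xt with t in P, then dz = x dt, and fullness puts dt into M. *)
Lemma kboundary_kcycle p e z :
  chain M p e z -> kboundary y x P P p e z -> kcycle y x M p e z.
Proof.
move=> zC [w [t [wC tC zE]]]; have [sP _] := gP; split=> //.
have zt : koszul y z = x *: koszul y t.
  by rewrite zE linearD /= koszulK add0r koszulZ.
exists (koszul y t) => //; apply: (koszul_full zC) => //.
case: (p) tC => [|p'] tC; last by rewrite -[e](subrK 1); apply: koszul_chain.
by rewrite (koszul_chain0 _ tC); apply: chain0.
Qed.

Lemma chain_xmultiples p e (z : {ffun {set 'I_q} -> V}) : chain xmultiples p e z ->
  exists2 t, chain P p (e - 1) t & z = x *: t.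
Proof.
move=> zC; have [|t tP] := @chain_choice K n q V
    (fun S v => P (e - 1) v /\ z S = x *: v) p.
  by move=> S _; have [[_ [u Pu zu]] _] := zC S; exists u.
have [sP _] := gP; exists t => [S|]; last apply/ffunP => S; have [tS t0] := tP S.
  split=> //; have [/tS [] //|/t0 ->] := eqVneq #|S| p; exact: subspace0.
rewrite ffunE; have [/tS [] //|ne] := eqVneq #|S| p.
by rewrite t0 // scaler0; have [_ ->] := zC S.
Qed.

(** [B'] collects the cycles that become boundaries once multiples of x may be taken in P. Modulo
    true boundaries it consists of the chains of [xmultiples] modulo [xmod]. The remainder h is the
    homology of the image of M in P/xP. *)
Lemma strand_decomposition p e b s :
  quot_dim (kcycle y x M p e) (kboundary y x M M p e) b ->
  quot_dim (xmultiples e) (xmod e) s ->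
  exists2 h, b = ('C(q, p) * s + h)%N &
    h = 0%N <-> forall z, kcycle y x M p e z -> kboundary y x M P p e z.
Proof.
move=> bdim sdim; have [sM _] := gM; have [sP _] := gP.
pose B' z := chain M p e z /\ kboundary y x M P p e z.
have sB := subspace_kboundary y x p (sM (e - 1)) (sM (e - 1)).
have sB' : subspace B'.
  have [c0 cL] := @subspace_chain K n q V M p e (sM e).
  have [d0 dL] := subspace_kboundary y x p (sM (e - 1)) (sP (e - 1)).
  by split=> // a u v [uc ud] [vc vd]; split; [apply: cL|apply: dL].
have [k1 [k2 [bE k1dim k2dim]]] : exists k1 k2, [/\ b = (k1 + k2)%N,
    quot_dim B' (kboundary y x M M p e) k1 & quot_dim (kcycle y x M p e) B' k2].
  apply: quot_dim_split bdim => //; first exact: subspace_kcycle.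
    move=> z zB; split; first exact: kboundary_chain zB.
    by apply: kboundary_sub zB.
  by move=> z [zC zB]; apply: kboundary_kcycle zC _; apply: kboundary_sub zB.
have {bdim} k1E : k1 = ('C(q, p) * s)%N.
  apply: (quot_dim_uniq sB k1dim).
  have := @quot_dim_chain K n V q xmultiples xmod p e s (subspace_xmultiples e)
    (subspace_xmod e) sdim.
  apply: (@quot_dim_iso _ _ _ _ _ _ _ _ (fun sg z => chain xmultiples p e sg /\
    kboundary y x M M p e (z - sg))).
  - split; first by apply: chain0; apply: subspace_xmultiples.
    by rewrite subr0; apply: (subspace0 sB).
  - move=> a g1 z1 g2 z2 [g1C h1] [g2C h2]; split.
      by have [_] := @subspace_chain K n q V xmultiples p e (subspace_xmultiples e); apply.
    have [_ /(_ a _ _ h1 h2)] := sB; congr kboundary.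
    by rewrite opprD addrACA scalerBr.
  - move=> g gC; exists g; last by split=> //; rewrite subrr; apply: (subspace0 sB).
    have [t tC gt] := chain_xmultiples gC; split.
      by apply: chain_sub gC => v [].
    exists 0, t; split=> //; first exact: chain0.
    by rewrite linear0 add0r.
  (* As [koszul y w] is a boundary, [x *: t] represents the same class. *)
  - move=> z [zC [w [t [wC tC zE]]]].
    have kwC : chain M p e (koszul y w) by rewrite -[e](subrK 1); apply: koszul_chain.
    have xtC : chain M p e (x *: t).
      by rewrite -[x *: t](addKr (koszul y w)) -zE addrC; apply: chainB.
    have gC : chain xmultiples p e (x *: t).
      move=> S; have [Mx x0] := xtC S; split=> //; split=> //.
      by exists (t S); [have [] := tC S|rewrite ffunE].
    exists (x *: t) => //; split=> //.
    exists w, 0; split=> //; first exact: chain0.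
    by rewrite zE addrK scaler0 addr0.
  - move=> g z [gC h]; have -> : kboundary y x M M p e z <-> kboundary y x M M p e g.
      split=> [zB|gB]; first by rewrite -[g](subKr z); apply: (subspaceB sB).
      by rewrite -[z](subrK g); apply: (subspaceD sB).
    have [t tC gt] := chain_xmultiples gC; split=> [gX|[w [u [wC uC gE]]]].
      have [|u uP] := @chain_choice K n q V (fun S v => M (e - 1) v /\ g S = x *: v) p.
        by move=> S _; have [[u Mu ->] _] := gX S; exists u.
      exists 0, u; split; first exact: chain0.
        move=> S; have [uS u0] := uP S; split=> //.
        by have [/uS [] //|/u0 ->] := eqVneq #|S| p; apply: subspace0.
      rewrite linear0 add0r; apply/ffunP => S; have [uS u0] := uP S; rewrite ffunE.
      have [/uS [] //|ne] := eqVneq #|S| p.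
      by rewrite u0 // scaler0; have [_ ->] := gC S.
    (* [x *: (t - u)] is the differential of a chain of M, so fullness puts [t - u], and with it
       [t], into M. *)
    have tuC : chain M p (e - 1) (t - u).
      apply: (koszul_full (p := p.+1) wC).
        by apply: chainB => //; apply: chain_sub uC => v; apply: MP.
      by rewrite scalerBr -gt gE addrK.
    have tM : chain M p (e - 1) t by rewrite -[t](subrK u); apply: chainD.
    move=> S; have [Mt t0] := tM S; rewrite gt ffunE; split; first by exists (t S).
    by move=> /t0 ->; rewrite scaler0.
exists k2; first by rewrite -k1E.
have k20 := quot_dim_eq0 k2dim; split=> [/k20 h z /h []//|h].
by apply/k20 => z zC; split; [case: zC|apply: h].
Qed.

End Strand.

Section HomogeneousDimension.
Variables (K : fieldType) (n : nat).
Local Notation R := {mpoly K[n]}.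

Definition homog_row (e : int) (v : 'rV[R]_1) : Prop := zhomog e (v 0 0).

Lemma homog_rowE e v : homog_row e v <-> gfree (fun _ : 'I_1 => 0) e v.
Proof.
by split=> [h l|/(_ 0)]; rewrite ?[l]ord1 subr0.
Qed.

Lemma graded_homog_row : graded_submod homog_row.
Proof.
have [sG gG] := graded_gfree K n (fun _ : 'I_1 => 0).
split=> [e|e l v hl /homog_rowE hv]; last exact/homog_rowE/gG.
have [G0 GL] := sG e; split=> [|c u v /homog_rowE hu /homog_rowE hv].
  exact/homog_rowE.
exact/homog_rowE/GL.
Qed.

Lemma homog_row_finite e : exists k, quot_dim (homog_row e) (fun v => v = 0) k.
Proof.
(* The bound on the degree only makes the type finite; for negative e the second condition leaves it
   empty. *)
pose T : finType := {m : 'X_{1..n < `|e|.+1} | (mdeg m)%:Z == e}.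
pose mon (t : T) : 'X_{1..n} := bmnm (val t).
have mon_inj : injective mon by move=> t u /val_inj /val_inj.
have coefE (c : T -> K) t : 
    ((\sum_t (c t)%:MP *: (const_mx 'X_[mon t] : 'rV[R]_1)) 0 0)@_(mon t) = c t.
  rewrite summxE linear_sum (bigD1 t) //= !mxE mul_mpolyC mcoeffZ mcoeffX eqxx mulr1.
  rewrite big1 ?addr0 // => u ut.
  by rewrite !mxE mul_mpolyC mcoeffZ mcoeffX (inj_eq mon_inj) (negPf ut) mulr0.
exists #|T|; apply: (quot_dim_fin (v := fun t => const_mx 'X_[mon t])).
- move=> t; rewrite /homog_row mxE; have := valP t => /= /eqP {1}<-.
  exact: zhomogX.
- move=> z /zhomogP hz; exists (fun t => (z 0 0)@_(mon t)).
  apply/matrixP => i j; rewrite [i]ord1 [j]ord1 [RHS]mxE; apply/mpolyP => m.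
  rewrite mxE [X in _ + X]mxE mcoeff0 mcoeffB; apply/eqP; rewrite subr_eq0; apply/eqP.
  have [me|me] := eqVneq (mdeg m)%:Z e.
    have lt : (mdeg m < `|e|.+1)%N by rewrite -me ltnS absz_nat.
    have [t <-] : exists t : T, mon t = m.
      have mT : (mdeg (BMultinom lt))%:Z == e by apply/eqP.
      by exists (exist _ (BMultinom lt) mT).
    by rewrite coefE.
  rewrite (_ : (z 0 0)@_m = 0); last by apply/eqP/negPn/negP => /hz /eqP; rewrite (negPf me).
  rewrite summxE linear_sum big1 // => t _ /=.
  rewrite !mxE mul_mpolyC mcoeffZ mcoeffX; case: eqP => [tm|]; last by rewrite mulr0.
  by have := valP t => /= /eqP; rewrite -/(mon t) tm => /eqP; rewrite (negPf me).
- by move=> c c0 t; rewrite -coefE c0 mxE mcoeff0.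
Qed.

Lemma homog_row_quot_finite e (Z B : 'rV[R]_1 -> Prop) :
  subspace Z -> subspace B ->
  (forall v, B v -> Z v) -> (forall v, Z v -> homog_row e v) ->
  exists k, quot_dim Z B k.
Proof.
move=> sZ sB BZ ZP; have [k kdim] := homog_row_finite e.
have s0 : subspace (fun v : 'rV[R]_1 => v = 0).
  by split=> // c u v -> ->; rewrite scaler0 addr0.
have [sP _] := graded_homog_row.
have [|k1 [_ [_ k1dim _]]] := quot_dim_split (sP e) s0 sZ _ ZP kdim.
  by move=> z ->; apply: (subspace0 sZ).
have [|_ [k2 [_ _ k2dim]]] := quot_dim_split sZ s0 sB _ BZ k1dim.
  by move=> z ->; apply: (subspace0 sB).
by exists k2.
Qed.

End HomogeneousDimension.

(** * The ideal mI and the choice of a linear x *)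

Section LinearForm.
Variables (K : fieldType) (n : nat) (I : {mpoly K[n]} -> Prop).
Hypothesis I_ideal : is_ideal I.
Local Notation mI := (ideal_mul (@max_ideal K n) I).

Lemma ideal0 : I 0. Proof. by case: I_ideal. Qed.

Lemma idealD f g : I f -> I g -> I (f + g).
Proof. by case: I_ideal => _ D _; apply: D. Qed.

Lemma idealM a f : I f -> I (a * f).
Proof. by case: I_ideal => _ _; apply. Qed.

Lemma idealN f : I f -> I (- f).
Proof. by rewrite -mulN1r; apply: idealM. Qed.

Lemma idealB f g : I f -> I g -> I (f - g).
Proof. by move=> If Ig; apply: idealD => //; apply: idealN. Qed.

Lemma ideal_sum (J : Type) (r : seq J) (Q : pred J) f :
  (forall j, Q j -> I (f j)) -> I (\sum_(j <- r | Q j) f j).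
Proof. by move=> If; apply: big_ind => //; [apply: ideal0|apply: idealD]. Qed.

Lemma ideal_mulP f :
  mI f <-> exists2 c : 'I_n -> {mpoly K[n]}, forall i, I (c i) & f = \sum_i 'X_i * c i.
Proof.
split=> [[r [a [b [/fin_all_exists [c cE] Ib ->]]]]|[c Ic ->]].
  exists (fun i => \sum_t c t i * b t).
    by move=> i; apply: ideal_sum => t _; apply: idealM.
  under [RHS]eq_bigr => i _ do rewrite mulr_sumr.
  rewrite exchange_big /=; apply: eq_bigr => t _; rewrite cE mulr_suml.
  by apply: eq_bigr => i _; rewrite mulrA [_ * c t i]mulrC.
exists n, (fun i => 'X_i), c; split=> // i.
exists (fun j => (j == i)%:R); rewrite (bigD1 i) //= eqxx mul1r big1 ?addr0 //.
by move=> j /negPf ->; rewrite mul0r.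
Qed.

Lemma ideal_mulD f g : mI f -> mI g -> mI (f + g).
Proof.
move=> /ideal_mulP [a Ia ->] /ideal_mulP [b Ib ->]; apply/ideal_mulP.
exists (fun i => a i + b i); first by move=> i; apply: idealD.
by rewrite -big_split; apply: eq_bigr => i _; rewrite mulrDr.
Qed.

Lemma ideal_mulM a f : mI f -> mI (a * f).
Proof.
move=> /ideal_mulP [b Ib ->]; apply/ideal_mulP.
exists (fun i => a * b i); first by move=> i; apply: idealM.
by rewrite mulr_sumr; apply: eq_bigr => i _; rewrite mulrCA.
Qed.

Lemma ideal_mulX i f : I f -> mI ('X_i * f).
Proof.
move=> If; apply/ideal_mulP; exists (fun j => if j == i then f else 0).
  by move=> j; case: eqP => // _; apply: ideal0.
rewrite (bigD1 i) //= eqxx big1 ?addr0 // => j /negPf ->.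
by rewrite mulr0.
Qed.

Lemma ideal_mul0 : mI 0.
Proof.
apply/ideal_mulP; exists (fun=> 0); first by move=> _; apply: ideal0.
by rewrite big1 // => i _; rewrite mulr0.
Qed.

Lemma ideal_mul_sum (J : Type) (r : seq J) (Q : pred J) f :
  (forall j, Q j -> mI (f j)) -> mI (\sum_(j <- r | Q j) f j).
Proof. by move=> h; apply: big_ind => //; [apply: ideal_mul0|apply: ideal_mulD]. Qed.

Hypothesis I_primary : m_primary I.

Lemma max_ideal_nilpotent : exists N, forall m, (N <= mdeg m)%N -> I 'X_[m].
Proof.
have /fin_all_exists [a aP] i : exists a, I ('X_i ^+ a).
  have [_ /(_ 'X_i) [_]] := I_primary; apply.
  by apply/max_idealP; rewrite mcoeffX mnm1_eq0.
exists (\sum_i a i).+1 => m; rewrite mdegE => lt.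
have [i ai] : exists i, (a i <= m i)%N.
  apply/existsP; rewrite -[[exists _, _]]negbK negb_exists; apply/negP => /forallP h.
  suff : (\sum_i m i <= \sum_i a i)%N by rewrite leqNgt lt.
  by apply: leq_sum => i _; apply: ltnW; rewrite ltnNge.
have -> : m = (m - U_(i) *+ a i + U_(i) *+ a i)%MM.
  apply/mnmP => j; rewrite mnmDE mnmBE mulmnE mnm1E; case: eqP => [<-|_] /=; lia.
by rewrite mpolyXD -mpolyXn; apply: idealM.
Qed.

Lemma ideal_max f : I f -> f@_0%MM = 0.
Proof.
have [_ /(_ f) [rad _]] := I_primary; move=> If; apply/max_idealP/rad.
by exists 1%N; rewrite expr1.
Qed.

(** If I = mI, induction on the degree shows that all coefficients of elements of I vanish; but I
    contains monomials. *)
Lemma ideal_mul_proper : (0 < n)%N -> ~ forall f, I f -> mI f.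
Proof.
move=> n_gt0 sub; have [N IN] := max_ideal_nilpotent.
have zero D : forall f, I f -> forall m, (mdeg m < D)%N -> f@_m = 0.
  elim: D => [//|D IH] f If m lt.
  have /sub/ideal_mulP [c Ic ->] := If; rewrite linear_sum big1 // => i _ /=.
  rewrite mcoeffXiM; case: ifP => // mi; apply: IH => //.
  have : mdeg m = (mdeg (m - U_(i)) + 1)%N.
    rewrite -(mdeg1 i) -mdegD; congr mdeg; apply/mnmP => j.
    rewrite mnmDE mnmBE mnm1E; case: eqP => [<-|_] /=; lia.
  by move: lt => /[swap] ->; rewrite addn1 ltnS.
pose m := (U_(Ordinal n_gt0) *+ N)%MM.
have mN : mdeg m = N by rewrite mdegMn mdeg1 mul1n.
have /zero/(_ m) : I 'X_[m] by apply: IN; rewrite mN.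
move=> /(_ N.+1); rewrite mN => /(_ (ltnSn N)) /eqP.
by rewrite mcoeffX eqxx oner_eq0.
Qed.

(* On the socle of R/I multiplication by an element of the maximal ideal depends
   modulo mI only on its linear part. *)
Lemma m_full_linear : (0 < n)%N -> m_full I ->
  exists c : 'I_n -> K, forall f, mI ((\sum_i c i *: 'X_i) * f) -> I f.
Proof.
move=> n_gt0 [x xP].
have x0 : x@_0%MM = 0.
  (* With a nonzero constant term x is a unit modulo m, and x f in mI for all f in I would give I =
     mI. *)
  apply: NNPP => x0; apply: (ideal_mul_proper n_gt0) => f If.
  have /max_idealP [c cE] : (x - (x@_0)%:MP)@_0%MM = 0.
    by rewrite mcoeffB mpolyCK subrr.
  have mxf : mI ((x - (x@_0)%:MP) * f).
    rewrite cE mulr_suml; apply: ideal_mul_sum => i _; rewrite -mulrA.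
    by apply: ideal_mulM; apply: ideal_mulX.
  have {mxf} : mI ((x@_0)^-1%:MP * (x * f + (-1) * ((x - (x@_0)%:MP) * f))).
    apply: ideal_mulM; apply: ideal_mulD; first exact/xP.
    exact: ideal_mulM.
  rewrite mulN1r -mulrBl subKr mulrA -mpolyCM mulVf ?mpolyC1 ?mul1r //.
  exact/eqP.
have /max_idealP [a aE] := x0; exists (fun i => (a i)@_0%MM).
set l := \sum_i _; have [N IN] := max_ideal_nilpotent.
(* Induction on a power of m that carries f into I. The induction hypothesis for the ['X_i * f] puts
   f into the socle, and there [x - l], lying in the square of m, carries f into mI. *)
have descend D : forall f, (forall m, (D <= mdeg m)%N -> I ('X_[m] * f)) ->
    mI (l * f) -> I f.
  elim: D => [f h _|D IH f h mlf].
    by have := h 0%MM (leq0n _); rewrite mpolyX0 mul1r.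
  have soc i : I ('X_i * f).
    apply: IH => [m Dm|]; last by rewrite mulrCA; apply: ideal_mulM.
    by rewrite mulrA -mpolyXD; apply: h; rewrite mdegD mdeg1 addn1.
  apply/xP; rewrite /ideal_colon -[x](subrK l) mulrDl; apply: ideal_mulD => //.
  rewrite aE /l -sumrB mulr_suml; apply: ideal_mul_sum => i _.
  rewrite -mul_mpolyC -mulrBl.
  have /max_idealP [b ->] : (a i - ((a i)@_0%MM)%:MP)@_0%MM = 0.
    by rewrite mcoeffB mpolyCK subrr.
  rewrite !mulr_suml; apply: ideal_mul_sum => j _; rewrite -!mulrA.
  by apply: ideal_mulM; apply: ideal_mulX.
move=> f; apply: (descend N) => m /IN Im; rewrite mulrC; exact: idealM.
Qed.

End LinearForm.

(** * Betti numbers and the Lefschetz property for an m-full ideal *)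

Section MFull.
Variables (K : fieldType) (q : nat) (I : {mpoly K[q.+1]} -> Prop).
Local Notation R := {mpoly K[q.+1]}.
Hypothesis I_ideal : is_ideal I.
Hypothesis I_primary : m_primary I.
Variables (k : 'I_q.+1) (c : 'I_q.+1 -> K).
Hypothesis ck : c k != 0.
Local Notation x := (linform c).
Local Notation y := (yvar K k).
Hypothesis x_full : forall f, ideal_mul (@max_ideal K q.+1) I (x * f) -> I f.

Definition ideal_row (e : int) (v : 'rV[R]_1) : Prop := zhomog e (v 0 0) /\ I (v 0 0).
Local Notation M := ideal_row.
Local Notation P := (@homog_row K q.+1).

(** For x f in I, the product of x with ['X_i * f] lies in mI, so m-fullness puts ['X_i * f] into
    I. *)
Lemma socle_linear f l : I (x * f) -> l \is 1.-homog for mdeg -> I (l * f).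
Proof.
move=> Ixf l_lin; have /max_idealP [r ->] := mcoeff0_lin l_lin.
rewrite mulr_suml; apply: ideal_sum => // i _; rewrite -mulrA; apply: idealM => //.
by apply: x_full; rewrite mulrCA; apply: ideal_mulX.
Qed.

Lemma graded_ideal_row : graded_submod M.
Proof.
have [sP gP] := graded_homog_row K q.+1.
split=> [e|e l v l_lin [hv Iv]]; last first.
  by split; [apply: gP|rewrite mxE; apply: idealM].
have [P0 PL] := sP e.
split=> [|a u v [hu Iu] [hv Iv]].
  by split=> //; rewrite mxE; apply: ideal0.
split; first exact: (PL a u v).
by rewrite !mxE; apply: idealD => //; apply: idealM.
Qed.

Lemma ideal_row_full e u (w : 'I_q -> 'rV[R]_1) :
  P e u -> (forall i, M e (w i)) -> x *: u = \sum_i y i *: w i -> M e u.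
Proof.
move=> Pu Mw E; split=> //; apply: x_full.
have := congr1 (fun v : 'rV[R]_1 => v 0 0) E; rewrite summxE mxE => ->.
apply: ideal_mul_sum => // i _; rewrite mxE; apply: ideal_mulX => //.
by case: (Mw i).
Qed.

Lemma ideal_row_sub e v : M e v -> P e v.
Proof. by case. Qed.

Lemma homog_row_exact p e z :
  (0 < p)%N -> kcycle y x P p e z -> kboundary y x P P p e z.
Proof.
case: p => // p _ zC; apply: (@kboundary_sub _ _ _ _ _ _ (gfree (fun _ : 'I_1 => 0)) _
  (gfree (fun _ : 'I_1 => 0))); try by move=> d v /homog_rowE.
apply: (gfree_exact ck); apply: kcycle_sub zC => d v; by move/homog_rowE.
Qed.

(** In positive degree R/xR has no Koszul homology; in degree 0 the class vanishes because I lies in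
    m. *)
Lemma ideal_row_exact p e z : kcycle y x M p e z -> kboundary y x P P p e z.
Proof.
case: p => [|p] zC; last first.
  by apply: homog_row_exact => //; apply: kcycle_sub zC => d v; apply: ideal_row_sub.
apply: (@kboundary_sub _ _ _ _ _ _ (gfree (fun _ : 'I_1 => 0)) _
  (gfree (fun _ : 'I_1 => 0))); try by move=> d v /homog_rowE.
have [zM _] := zC; apply/kboundary0P => //.
  by apply: chain_sub zM => v [hv _]; apply/homog_rowE.
by move=> l; rewrite [l]ord1; apply: (ideal_max I_primary); have [[]] := zM set0.
Qed.

Lemma chain_top (V : lmodType R) (N : int -> V -> Prop) e (z : {ffun {set 'I_q} -> V}) :
  @chain K q.+1 q V N q.+1 e z -> z = 0.
Proof.
move=> zC; apply/ffunP => S; have [_ ->] := zC S; first by rewrite ffunE.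
by have := max_card (mem S); rewrite card_ord neq_ltn ltnS => ->.
Qed.

(** There are no chains of degree q + 1, so only a multiple of x remains. *)
Lemma top_strand e z : kcycle y x M q e z -> kboundary y x M P q e z.
Proof.
move=> /ideal_row_exact [w [t [wC tC ->]]]; exists 0, t; split=> //.
  by apply: chain0; have [] := graded_ideal_row.
by rewrite (chain_top wC).
Qed.

(* R_e is contained in I + xR. *)
Definition covered (e : int) : Prop :=
  forall r, zhomog e r -> exists2 f, zhomog (e - 1) f & I (r - x * f).

Lemma coveredS (e : nat) : covered e%:Z -> covered e.+1%:Z.
Proof.
move=> cov r hr.
have r0 : r@_0%MM = 0.
  by apply/eqP/negPn/negP => /(zhomogP e.+1 r).1 -/(_ hr); rewrite mdeg0.
have [a ha rE] := sum_var_decomposition r0 hr.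
have eE : e.+1%:Z - 1 = e%:Z by rewrite -addn1 PoszD addrK.
have /fin_all_exists [f fP] i : exists f, zhomog (e%:Z - 1) f /\ I (a i - x * f).
  by have [|f hf If] := cov (a i); [rewrite -eE|exists f].
exists (\sum_i f i * 'X_i).
  apply: big_ind => [|*|i _]; [exact: zhomog0|exact: zhomogD|].
  have [hf _] := fP i; rewrite eE -[e%:Z](subrK 1); apply: zhomogM => //.
  by have := zhomogX K U_(i); rewrite mdeg1.
rewrite rE mulr_sumr -sumrB; apply: ideal_sum => // i _.
rewrite mulrA -mulrBl mulrC; apply: idealM => //; by case: (fP i).
Qed.

Lemma covered_le (e f : nat) : (e <= f)%N -> covered e%:Z -> covered f%:Z.
Proof.
move=> /subnK <- cov; elim: (f - e)%N => [//|a IH].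
by rewrite addSn; apply: coveredS.
Qed.

(** Write z = dw + xt over R. The entries of w have degree e - 1, so they can be moved into I by
    multiples of x, which t absorbs. *)
Lemma covered_strand p (e : int) z :
  covered (e - 1) -> kcycle y x M p e z -> kboundary y x M P p e z.
Proof.
move=> cov /ideal_row_exact [w [t [wC tC ->]]].
have [sM _] := graded_ideal_row; have [sP gP] := graded_homog_row K q.+1.
have [|u uP] := @chain_choice K q.+1 q 'rV[R]_1
    (fun S v => P (e - 1 - 1) v /\ I ((w S - x *: v) 0 0)) p.+1.
  move=> S _; have [Pw _] := wC S; have [f hf If] := cov _ Pw.
  by exists (const_mx f); split; rewrite /homog_row !mxE.
have uC : chain P p.+1 (e - 1 - 1) u.
  move=> S; have [uS u0] := uP S; split=> //.
  by have [/uS [] //|/u0 ->] := eqVneq #|S| p.+1; apply: (subspace0 (sP _)).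
have xuC : chain P p.+1 (e - 1) (x *: u).
  rewrite -[e - 1](subrK 1); apply: chain_scale => //; exact: linform_homog.
exists (w - x *: u), (koszul y u + t); split.
- have wuC := chainB (sP _) wC xuC.
  move=> S; have [Pwu wu0] := wuC S; split=> //; split=> //.
  have [uS u0] := uP S; have [/uS []|ne] := eqVneq #|S| p.+1.
    by rewrite !ffunE.
  by rewrite wu0 // mxE; apply: ideal0.
- apply: chainD => //; rewrite -[e - 1](subrK 1); apply: koszul_chain => //.
  exact: yvar_homog.
by rewrite linearB /= koszulZ scalerDr addrA subrK.
Qed.

(** Descending induction, from a degree where I contains all forms. By the case of degree e + 1, the
    form r times the top basis vector has its differential in I modulo x, so r represents a socle
    element of R/(I + xR); the strand condition then puts r into I + xR. *)
Lemma strand_covered (d : nat) : (0 < q)%N ->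
  (forall e : nat, (d <= e)%N -> forall z,
     kcycle y x M q.-1 e.+1%:Z z -> kboundary y x M P q.-1 e.+1%:Z z) ->
  covered d%:Z.
Proof.
move=> q_gt0 strand.
have [sM _] := graded_ideal_row; have [sP gP] := graded_homog_row K q.+1.
have [N IN] := max_ideal_nilpotent I_ideal I_primary.
suff cov a : forall e : nat, (d <= e)%N -> (N <= e + a)%N -> covered e%:Z.
  by apply: (cov N) => //; rewrite leq_addl.
elim: a => [|a IH] e de.
  rewrite addn0 => Ne r /zhomogP hr; exists 0; first exact: zhomog0.
  rewrite mulr0 subr0 [r]mpolyE big_seq; apply: ideal_sum => // m.
  rewrite mcoeff_msupp => /hr [mE]; rewrite -mul_mpolyC; apply: idealM => //.
  by apply: IN; rewrite mE.
rewrite addnS -addSn => /IH -/(_ (leqW de)) cov r hr.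
have eE : e.+1%:Z - 1 = e%:Z by rewrite -addn1 PoszD addrK.
have eE' : e%:Z + 1 = e.+1%:Z by rewrite -addn1.
have qE : q.-1.+1 = q by rewrite prednK.
pose top := [ffun S : {set 'I_q} => if S == setT then const_mx r else 0]
  : {ffun {set 'I_q} -> 'rV[R]_1}.
have topC : chain P q e%:Z top.
  move=> S; rewrite ffunE; case: eqP => [->|nT].
    by rewrite /homog_row mxE; split=> //; rewrite cardsT card_ord eqxx.
  split=> //; exact: (subspace0 (sP _)).
have ktopC : chain P q.-1 e.+1%:Z (koszul y top).
  by rewrite -eE'; apply: koszul_chain; rewrite ?qE //; apply: yvar_homog.
have [|u uP] := @chain_choice K q.+1 q 'rV[R]_1
    (fun S v => P e%:Z v /\ I ((koszul y top S - x *: v) 0 0)) q.-1.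
  move=> S _; have [Pk _] := ktopC S; have [f hf If] := cov _ Pk.
  by exists (const_mx f); rewrite /homog_row !mxE -eE; split=> //; move: If; rewrite !mxE.
have uC : chain P q.-1 e%:Z u.
  move=> S; have [uS u0] := uP S; split=> //.
  by have [/uS [] //|/u0 ->] := eqVneq #|S| q.-1; apply: (subspace0 (sP _)).
pose z := koszul y top - x *: u.
have xuC : chain P q.-1 e.+1%:Z (x *: u).
  by rewrite -eE'; apply: chain_scale => //; apply: linform_homog.
have zC : chain M q.-1 e.+1%:Z z.
  have zP := chainB (sP _) ktopC xuC.
  move=> S; have [Pz z0] := zP S; split=> //; split=> //.
  have [uS u0] := uP S; have [/uS []|ne] := eqVneq #|S| q.-1.
    by rewrite /z !ffunE.
  by rewrite z0 // mxE; apply: ideal0.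
have [|w [t [wC tC zE]]] := strand e de z.
  apply: (kboundary_kcycle (yvar_homog K k) graded_ideal_row
    (graded_homog_row K q.+1) ideal_row_full zC).
  exists top, (- u); rewrite eE qE; split=> //; first exact: chainN.
  by rewrite scalerN.
move: wC tC; rewrite eE qE => wC tC.
(* Corrected by the chain [w] of I, [top] is a cycle of top degree over R, hence a multiple of x;
   its single entry shows that r lies in I + xR. *)
have twC : kcycle y x P q e%:Z (top - w).
  split.
    by apply: chainB => //; apply: chain_sub wC => v [].
  exists (t + u); first exact: chainD.
  rewrite linearB /= scalerDr; apply/eqP; rewrite subr_eq.
  by rewrite -[koszul y top](subrK (x *: u)) -/z zE -addrA addrC.
have [w' [t' [w'C t'C E]]] := homog_row_exact q_gt0 twC.
rewrite (chain_top w'C) linear0 add0r in E.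
exists (t' setT 0 0); first by have [] := t'C setT.
have /(congr1 (fun v : 'rV[R]_1 => v 0 0)) := congr1 (fun f : {ffun {set 'I_q} -> 'rV[R]_1} => f setT) E.
rewrite !ffunE eqxx !mxE => <-; rewrite subKr.
by have [[]] := wC setT.
Qed.

Variable F : graded_free_resolution I.

Lemma betti_koszul (p : nat) (e : int) :
  quot_dim (kcycle y x M p e) (kboundary y x M M p e) (betti F p (p%:Z + e)).
Proof.
have sub1 d v : syz (F := F) (i := 0) d v -> M d v by move/syz0P.
have sub2 d v : M d v -> syz (F := F) (i := 0) d v by move=> h; apply/syz0P.
have : quot_dim (kcycle y x (@syz K q I F 0) p e)
    (kboundary y x (@syz K q I F 0) (@syz K q I F 0) p e) (betti F p (p%:Z + e)).
  case: p => [|p]; first by rewrite add0r; apply: (betti_koszul0 ck).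
  by rewrite addrC; apply: (betti_koszulS ck F p 0).
apply: quot_dim_ext => z; split.
- exact: (kcycle_sub sub1).
- exact: (kcycle_sub sub2).
- exact: (kboundary_sub sub1 sub1).
- exact: (kboundary_sub sub2 sub2).
Qed.

Lemma betti_top (e : int) :
  quot_dim (xmultiples x M P e) (xmod x M e) (betti F q (q%:Z + e)).
Proof.
have gM := graded_ideal_row; have gP := graded_homog_row K q.+1.
have [||v [u Mu ->]|v [[]] //|s sdim] := @homog_row_quot_finite K q.+1 e
    (xmultiples x M P e) (xmod x M e).
- exact: subspace_xmultiples.
- exact: subspace_xmod.
- split; last by exists u => //; apply: ideal_row_sub.
  have [_ mM] := gM; rewrite -[e](subrK 1); apply: mM => //; exact: linform_homog.
have [h bE [_ h0]] := strand_decomposition (linform_homog c) (yvar_homog K k) gM gP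
  ideal_row_sub ideal_row_full (betti_koszul q e) sdim.
by rewrite bE binn mul1n h0 ?addn0 //; apply: top_strand.
Qed.

Lemma betti_strand (p : nat) (e : int) :
  exists2 h, betti F p (p%:Z + e) = ('C(q, p) * betti F q (q%:Z + e) + h)%N &
    h = 0%N <-> forall z, kcycle y x M p e z -> kboundary y x M P p e z.
Proof.
exact: (strand_decomposition (linform_homog c) (yvar_homog K k) graded_ideal_row
  (graded_homog_row K q.+1) ideal_row_sub ideal_row_full (betti_koszul p e)
  (betti_top e)).
Qed.

(** The top Betti number at e detects the kernel of x in degree e - 1: hence the shift by one
    between d and the least socle degree. *)
Lemma betti_top_eq0 (e : int) :
  betti F q (q%:Z + e) = 0%N <-> forall r, zhomog (e - 1) r -> I (x * r) -> I r.
Proof.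
have x0 := linform_neq0 ck.
split=> [/(quot_dim_eq0 (betti_top e)).1 h r hr Ixr|h].
  have [|u [_ Iu]] := h (x *: const_mx r).
    split; last by exists (const_mx r) => //; rewrite /homog_row mxE.
    split; rewrite !mxE // -[e](subrK 1) addrC; apply: zhomogM => //.
    exact/zhomog_lin/linform_homog.
  move=> /matrixP /(_ 0 0); rewrite !mxE => /(mulfI x0) ->; exact: Iu.
apply/(quot_dim_eq0 (betti_top e)) => v [[_ Iv] [u Pu vE]].
exists u => //; split=> //; apply: h => //.
by move: Iv; rewrite vE mxE.
Qed.

Lemma top_degree_exists : exists t, is_top_degree I t.
Proof.
have [N IN] := max_ideal_nilpotent I_ideal I_primary.
have large (f : R) i : (N <= i)%N -> f \is i.-homog for mdeg -> I f.
  move=> Ni hf; rewrite [f]mpolyE big_seq; apply: ideal_sum => // m mf.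
  rewrite -mul_mpolyC; apply: idealM => //; apply: IN.
  by rewrite (dhomogP _ _ _ hf).
suff desc b : (forall i f, (b <= i)%N -> f \is i.-homog for mdeg -> I f) ->
    exists t, is_top_degree I t.
  by apply: (desc N) => i f Ni hf; apply: large hf.
elim: b => [h|b IH h].
  by have [[I1 _] _] := I_primary; case: I1; apply: (h 0%N) => //; apply: dhomog1.
have [[f [hf If]]|none] := classic (exists f, f \is b.-homog for mdeg /\ ~ I f).
  by exists b; split=> [|i g bi]; [exists f|apply: h].
apply: IH => i f; rewrite leq_eqVlt => /orP [/eqP <- hf|]; last exact: h.
by apply: NNPP => If; apply: none; exists f.
Qed.

(* The kernel of x on R/I is the socle, hence contained in the kernel of l; so
   rank x >= rank l in every degree. *)
Lemma surjective_linform (l : R) e : l \is 1.-homog for mdeg ->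
  mult_surjective I l e -> covered e.+1%:Z.
Proof.
move=> l_lin surj r /zhomog_nat hr.
have eE : e.+1%:Z - 1 = e%:Z by rewrite -addn1 PoszD addrK.
have [sP _] := graded_homog_row K q.+1.
pose kerx (v : 'rV[R]_1) := P e%:Z v /\ I (x * v 0 0).
have skerx : subspace kerx.
  have [P0 PL] := sP e%:Z; split=> [|a u v [Pu Iu] [Pv Iv]].
    by split=> //; rewrite mxE mulr0; apply: ideal0.
  split; first exact: PL.
  by rewrite !mxE mulrDr mulrCA; apply: idealD => //; apply: idealM.
(* For a basis [v] of R_e modulo the kernel of x, the [x *: v i] are independent modulo I, and the
   [l *: v i] span degree e + 1 because l kills that kernel. *)
have [a [v [Pv sv fv]]] : exists a, quot_dim (P e%:Z) kerx a.
  by apply: (@homog_row_quot_finite K q.+1 e%:Z _ _ (sP _) skerx) => // v [].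
pose B (w : 'rV[R]_1) := I (w 0 0).
have sB : subspace B.
  split=> [|b u w Iu Iw]; rewrite /B !mxE; first exact: ideal0.
  by apply: idealD => //; apply: idealM.
have lcZ (g : R) b : lcomb (fun i => g *: v i) b = g *: lcomb v b.
  by rewrite scaler_sumr; apply: eq_bigr => i _; rewrite !scalerA mulrC.
have span (w : R) : w \is e.+1.-homog for mdeg ->
    exists b, I (w - l * (lcomb v b) 0 0).
  move=> /surj [f hf Iw].
  have [|b [_ Ib]] := sv (const_mx f); first by rewrite /homog_row mxE; apply/zhomog_nat.
  exists b; have := idealD I_ideal Iw (socle_linear Ib l_lin).
  by rewrite !mxE mulrBr addrA subrK.
have [i|b Bb|C freeC CE] := @independent_coordinates K q.+1 'rV[R]_1 B a a
    (fun i => x *: v i) (fun i => l *: v i) sB.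
- have [|b Ib] := span (x * v i 0 0).
    by rewrite -[e.+1]add1n; apply: dhomogM; [apply: linform_homog|apply/zhomog_nat/Pv].
  by exists b; rewrite lcZ /B !mxE.
- apply: fv; split; first by apply: subspace_lcomb.
  by move: Bb; rewrite lcZ /B mxE.
have [b Ib] := span r hr.
(* C is square with independent rows, hence invertible, so the [x *: v i] span as well. *)
have := CE (b *m invmx C); rewrite mulmxKV -?row_free_unit // !lcZ => Ib'.
exists ((lcomb v (b *m invmx C)) 0 0).
  by rewrite eE; apply: (@subspace_lcomb _ _ _ (P e%:Z)) => //; apply: sP.
have := idealB I_ideal Ib Ib'; rewrite !mxE.
by rewrite opprB addrA subrK.
Qed.

Lemma weak_Lefschetz_covered (e : nat) :
  (0 < betti F q (q%:Z + e.+1%:Z))%N ->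
  (forall j : int, (0 < betti F q (q%:Z + j))%N -> e.+1%:Z <= j) ->
  weak_Lefschetz I <-> covered e.+1%:Z.
Proof.
move=> attained minimal.
have nE i : i.+1%:Z - 1 = i%:Z by rewrite -addn1 PoszD addrK.
(* A nonzero socle element in degree e = d - 1; it keeps every linear form from being injective
   there. *)
have [r [hr [Ixr Ir]]] : exists r, r \is e.-homog for mdeg /\ I (x * r) /\ ~ I r.
  apply: NNPP => none; move: attained; rewrite lt0n => /eqP; apply.
  apply/betti_top_eq0 => r; rewrite nE => /zhomog_nat hr Ixr.
  by apply: NNPP => Ir; apply: none; exists r.
split=> [[l l_lin [t [_ top] full]]|cov].
  (* Full rank is known only below the top degree t; for e >= t all forms of degree e + 1 lie in
     I. *)
  have [et|te] := ltnP e t; last first.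
    move=> f /zhomog_nat hf; exists 0; first exact: zhomog0.
    by rewrite mulr0 subr0; apply: top hf; rewrite ltnS.
  have [inj|] := full e et; last exact: surjective_linform.
  by case: Ir; apply: inj => //; apply: socle_linear.
have [t topt] := top_degree_exists.
exists x; first exact: linform_homog.
exists t => // i _; have [ie|ei] := ltnP i e; [left|right].
  move=> f hf Ixf; have /betti_top_eq0 h : betti F q (q%:Z + i.+1%:Z) = 0%N.
    apply/eqP; rewrite -leqn0 leqNgt; apply/negP => /minimal.
    by rewrite lez_nat ltnS leqNgt ie.
  by apply: h Ixf; rewrite nE; apply/zhomog_nat.
move=> g /zhomog_nat hg; have [|f hf If] := covered_le _ cov hg (f := i.+1).
  by rewrite ltnS.
by exists f => //; apply/zhomog_nat; rewrite -nE.
Qed.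

End MFull.

Theorem theorem10 (K : fieldType) (n : nat) (I : {mpoly K[n]} -> Prop)
    (F : graded_free_resolution I) (d : int)
    (K_infinite : infinite K) (n_ge1 : (1 <= n)%N)
    (I_ideal : is_ideal I) (I_homog : is_homogeneous I)
    (I_primary : m_primary I) (I_full : m_full I)
    (d_attained : (0 < betti F (n%:Z - 1) (n%:Z - 1 + d))%N)
    (d_minimal : forall j : int,
       (0 < betti F (n%:Z - 1) (n%:Z - 1 + j))%N -> d <= j) :
  (weak_Lefschetz I <->
   (forall j : int, d < j ->
      betti F (n%:Z - 1) (n%:Z - 1 + j) = betti F 0 j /\
      betti F (n%:Z - 2) (n%:Z - 2 + j) = ((n - 1) * betti F 0 j)%N)) /\
  ((forall j : int, d < j ->
      betti F (n%:Z - 1) (n%:Z - 1 + j) = betti F 0 j /\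
      betti F (n%:Z - 2) (n%:Z - 2 + j) = ((n - 1) * betti F 0 j)%N) <->
   (forall (j : int) (i : nat), d < j ->
      betti F i%:Z (i%:Z + j) = ('C(n - 1, i) * betti F 0 j)%N)).
Proof.
have [c x_full] := m_full_linear I_ideal I_primary n_ge1 I_full.
case: n n_ge1 I F I_ideal I_homog I_primary I_full d_attained d_minimal c x_full
  => [//|q] _ I F I_ideal I_homog I_primary I_full d_attained d_minimal c x_full.
have nE (i : nat) : i.+1%:Z - 1 = i%:Z by rewrite -addn1 PoszD addrK.
move: d_attained d_minimal; rewrite nE subn1 /= => d_attained d_minimal.
(* If x were zero, m-fullness would put 1 into I. *)
have [k ck] : exists k, c k != 0.
  apply/existsP; apply: contraT; rewrite negb_exists => /forallP c0.
  have [[I1 _] _] := I_primary; case: I1; apply: x_full.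
  rewrite big1 ?mul0r => [|i _]; first exact: ideal_mul0.
  by have := c0 i; rewrite negbK => /eqP ->; rewrite scale0r.
(* If d - 1 were negative, there would be no nonzero form of that degree and the top Betti number
   would vanish. *)
have [e dE] : exists e : nat, d = e.+1%:Z.
  case dE: (d - 1) => [e|e]; first by exists e; rewrite -[d](subrK 1) dE -PoszD addn1.
  move: d_attained; rewrite lt0n => /eqP; case.
  apply/(betti_top_eq0 I_ideal I_primary ck x_full F) => r; rewrite dE => hr _.
  have -> : r = 0 by move: hr; rewrite /zhomog /shifted_homog subr0.
  exact: ideal0.
subst d.
have pred_binomial : (0 < q)%N ->
    q.+1%:Z - 2 = q.-1%:Z /\ 'C(q, q.-1) = q.
  move=> q_gt0; split; first by lia.
  by rewrite -{1}(prednK q_gt0) binSn prednK.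
have wlp := weak_Lefschetz_covered I_ideal I_primary ck x_full d_attained d_minimal.
have strand := betti_strand I_ideal I_primary ck x_full F.
have to_iii : covered I c e.+1%:Z -> forall (j : int) (i : nat), e.+1%:Z < j ->
    betti F i%:Z (i%:Z + j) = ('C(q, i) * betti F 0 j)%N.
  move=> cov j i ej.
  have cov' : covered I c (j - 1).
    case: j ej => [[|j]|j] //; rewrite ltz_nat ltnS nE => ej.
    exact: covered_le ej cov.
  have vanish p h : h = 0%N <-> (forall z, kcycle (yvar K k) (linform c) (ideal_row I) p j z ->
      kboundary (yvar K k) (linform c) (ideal_row I) (@homog_row K q.+1) p j z) -> h = 0%N.
    by case=> _; apply => z; apply: covered_strand.
  (* Both remainders vanish, so the strands of index 0 and i are 1 and C(q, i) times the same top
     Betti number. *)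
  have [h0 b0 /vanish h00] := strand 0%N j; have [hi bi /vanish hi0] := strand i j.
  move: b0; rewrite bi hi0 h00 !addn0 add0r bin0 mul1n => ->.
  by [].
have iii_ii : (forall (j : int) (i : nat), e.+1%:Z < j ->
      betti F i%:Z (i%:Z + j) = ('C(q, i) * betti F 0 j)%N) ->
    forall j : int, e.+1%:Z < j -> betti F q (q%:Z + j) = betti F 0 j /\
      betti F (q.+1%:Z - 2) (q.+1%:Z - 2 + j) = (q * betti F 0 j)%N.
  move=> iii j ej; rewrite iii // binn mul1n; split=> //.
  (* For q = 0 the second identity concerns index -1, where the Betti number is 0 by definition, and
     reads 0 = 0. *)
  have [q0|/pred_binomial [-> bq]] := posnP q; last by rewrite iii // bq.
  have -> : q.+1%:Z - 2 = -1 by rewrite q0.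
  by rewrite [X in (X * _)%N]q0.
have ii_cov : (forall j : int, e.+1%:Z < j -> betti F q (q%:Z + j) = betti F 0 j /\
      betti F (q.+1%:Z - 2) (q.+1%:Z - 2 + j) = (q * betti F 0 j)%N) ->
    covered I c e.+1%:Z.
  (* With a single variable every form of positive degree is a multiple of x. *)
  move=> ii; have [q0|q_gt0] := posnP q.
    move=> r hr; have r0 : r@_0%MM = 0.
      by apply/eqP/negPn/negP => /((zhomogP _ _).1 hr); rewrite mdeg0.
    have [a [t [_ ht ->]]] := ideal_decomposition ck r0 hr; exists t => //.
    rewrite addrK big1 => [|i _]; first exact: ideal0.
    by have := ltn_ord i; rewrite {2}q0.
  apply: (strand_covered I_ideal I_primary ck x_full q_gt0) => e' ee'.
  have [h bE h0] := strand q.-1 e'.+1%:Z; apply/h0.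
  have [qE bq] := pred_binomial q_gt0.
  (* The strand of index q - 1 is q times the top Betti number plus h, and (ii) makes it q times
     that number, so h = 0. *)
  have [b0 b1] := ii e'.+1%:Z ee'; move: b1; rewrite qE bE bq b0; lia.
split.
  rewrite wlp; split=> [/to_iii /iii_ii //|]; exact: ii_cov.
split=> [/ii_cov /to_iii //|]; exact: iii_ii.
Qed.
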